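(* Let $n\in\mathbb{Z}$ with $|n|\geq1$, $\alpha>0$, $R>0$, and let $\kappa$ satisfy $$-\frac{n^2+r_0^2}{2R^2}<\kappa<\alpha^{-1}-\frac{n^2+r_0^2}{2R^2}\quad\text{and}\quad \left(\frac{6\,(1+n^2(2\ln2-1))}{\alpha^{-1}-\kappa}\right)^{1/2}<R.$$ Then there exists $u\in H$ with $u(r)>0$ for all $r\in(0,R)$ such that $(u,\kappa)$ is a solution of the $n$-vortex equation $$(ru_r)_r-\frac{n^2}{r}u+\frac{2ru^3}{1+\alpha u^2}-2\kappa ru=0\ \text{ on }(0,R),\qquad u(0)=0,\quad u(R)=0.$$
   Context: $r_0\approx2.404825$ is the first positive zero of the Bessel function $J_0$. $H$ is the completion of $\{u\in C^1[0,R]: u(0)=0=u(R)\}$ with respect to the inner product $(u,\tilde u)=\int_0^R\{ru_r\tilde u_r+\frac1r u\tilde u\}dr$. *)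

(* Defs.v *)
From HB Require Import structures.
From mathcomp Require Import all_boot all_order all_algebra.
From mathcomp Require Import all_classical all_reals all_analysis.
Set Implicit Arguments. Unset Strict Implicit. Unset Printing Implicit Defensive.
Import Order.TTheory GRing.Theory Num.Theory.
Import numFieldNormedType.Exports.
Local Open Scope classical_set_scope.
Local Open Scope ring_scope.

Definition besselJ0 {R : realType} (x : R) : R :=
  limn (fun N : nat => \sum_(k < N)
          ((-1) ^+ k * (x / 2) ^+ (2 * k) / (k`!%:R) ^+ 2)).

Definition first_pos_zero_J0 {R : realType} (r0 : R) : Prop :=
  0 < r0 /\ besselJ0 r0 = 0 /\ (forall x : R, 0 < x < r0 -> besselJ0 x != 0).

(* C^1 functions (defined on all of R; every C^1[0,R] function extends to one). *)
Definition C1 {R : realType} (v : R -> R) : Prop :=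
  (forall x : R, derivable v x 1) /\ continuous (derive1 v).

Definition Hdist2 {R : realType} (Rad : R) (u v : R -> R) : \bar R :=
  (\int[lebesgue_measure]_(r in `]0%R, Rad[%classic)
      ((r * (derive1 u r - derive1 v r) ^+ 2 + (u r - v r) ^+ 2 / r)%:E))%E.

(* u belongs to H, the completion of {v in C^1[0,R] : v(0) = 0 = v(R)} for the
   inner product (u,v) = int_0^R { r u_r v_r + u v / r } dr : u is the H-limit
   of a sequence of such functions (with u_r its derivative on (0,R)). *)
Definition in_H {R : realType} (Rad : R) (u : R -> R) : Prop :=
  (forall r : R, 0 < r < Rad -> derivable u r 1) /\
  exists w : nat -> R -> R,
    (forall k, C1 (w k) /\ w k 0 = 0 /\ w k Rad = 0) /\
    ((fun k => Hdist2 Rad (w k) u) @ \oo --> 0%E).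

Definition vortex_solution {R : realType} (n : int) (alpha kappa Rad : R)
    (u : R -> R) : Prop :=
  {within `[0, Rad], continuous u} /\ u 0 = 0 /\ u Rad = 0 /\
  forall r : R, 0 < r < Rad ->
    derivable u r 1 /\
    derivable (fun s : R => s * derive1 u s) r 1 /\
    derive1 (fun s : R => s * derive1 u s) r - (n%:~R) ^+ 2 / r * u r
      + 2 * r * u r ^+ 3 / (1 + alpha * u r ^+ 2) - 2 * kappa * r * u r = 0.

(* Main.v *)
Require Import Defs.
From HB Require Import structures.
From mathcomp Require Import all_boot all_order all_algebra.
From mathcomp Require Import all_classical all_reals all_analysis.
From mathcomp Require Import ring lra.
Import Order.TTheory GRing.Theory Num.Theory.
Import numFieldNormedType.Exports.
Local Open Scope ring_scope.

(** Shooting from the singular endpoint.  With m = |n| and u = a r^m w, w(0) = 1,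
    the equation becomes (r^(2m+1) w')' = - r^(2m+1) q(r, w), where q is globally
    Lipschitz in w and depends on a only through b = alpha a^2.  Hence w exists on
    the whole half-line (Picard iteration in an exponentially weighted norm) and
    depends continuously on b, down to the linear equation at b = 0.  For b = 0 a
    Wronskian with J_0(r0 r / R) shows that w has no zero on [0, R].  A Picone
    argument with the tent function min(r, R - r) shows that solutions of the
    equation linearized at infinity vanish in (0, R], and hence so does w for
    large b.  At the supremum b* of the parameters with w > 0 on [0, R], w is
    nonnegative and vanishes somewhere; double zeros being impossible, it vanishes
    only at R.  Extended by w = 1 to r <= 0, u is C^1 on the whole line, which
    makes its membership in H immediate. *)

Set Implicit Arguments.
Unset Strict Implicit.
Unset Printing Implicit Defensive.

(** * Calculus *)

Section Calculus.
Local Open Scope classical_set_scope.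
Local Open Scope ring_scope.
Context {R : realType}.
Implicit Types (f g q : R -> R) (x a b : R).

Lemma der_cst x (c : R) : is_derive x 1 (fun _ : R => c) 0.
Proof. exact: is_derive_cst. Qed.

Lemma der_id x : is_derive x 1 (fun t : R => t) 1.
Proof. exact: is_derive_id. Qed.

Lemma derD f g x df dg : is_derive x 1 f df -> is_derive x 1 g dg ->
  is_derive x 1 (fun t => f t + g t) (df + dg).
Proof. by move=> hf hg; exact: is_deriveD. Qed.

Lemma derN f x df : is_derive x 1 f df -> is_derive x 1 (fun t => - f t) (- df).
Proof. by move=> hf; exact: is_deriveN. Qed.

Lemma derM f g x df dg : is_derive x 1 f df -> is_derive x 1 g dg ->
  is_derive x 1 (fun t => f t * g t) (df * g x + f x * dg).
Proof.
move=> hf hg; have h := is_deriveM hf hg.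
suff -> : df * g x + f x * dg = f x *: dg + g x *: df by exact: h.
by rewrite /GRing.scale /= addrC (mulrC df).
Qed.

Lemma derX f x df n : is_derive x 1 f df ->
  is_derive x 1 (fun t => f t ^+ n) (n%:R * f x ^+ n.-1 * df).
Proof.
by move=> hf; have := is_deriveX n hf; rewrite exprfctE.
Qed.

Lemma derV f x df : f x != 0 -> is_derive x 1 f df ->
  is_derive x 1 (fun t => (f t)^-1) (- df / f x ^+ 2).
Proof.
move=> f0 hf; have h := is_deriveV f0 hf.
suff -> : - df / f x ^+ 2 = - f x ^- 2 *: df by exact: h.
by rewrite /GRing.scale /= mulNr mulNr mulrC.
Qed.

Lemma der_comp f g x df dg : is_derive x 1 f df -> is_derive (f x) 1 g dg ->
  is_derive x 1 (fun t => g (f t)) (dg * df).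
Proof.
move=> hf hg; have h := @is_derive1_comp _ g f x _ _ hg hf; exact: h.
Qed.

Lemma der_cont f x df : is_derive x 1 f df -> {for x, continuous f}.
Proof. by move=> [hf _]; apply: differentiable_continuous; exact/derivable1_diffP. Qed.

Lemma der_near f g x d : (\forall t \near x, f t = g t) ->
  is_derive x 1 f d -> is_derive x 1 g d.
Proof. by move=> fg; exact: near_eq_is_derive. Qed.

Lemma der_ge0_le f df a b : a <= b ->
  (forall x, a < x < b -> is_derive x 1 f (df x)) ->
  {within `[a, b], continuous f} ->
  (forall x, a < x < b -> 0 <= df x) -> f a <= f b.
Proof.
rewrite le_eqVlt => /orP[/eqP -> //|ab] hf cf h.
have hf' x : x \in `]a, b[ -> is_derive x 1 f (df x) by rewrite in_itv /=; exact: hf.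
have [c] := MVT ab hf' cf; rewrite in_itv /= -subr_ge0 => cab ->.
by rewrite mulr_ge0 ?h // subr_ge0 ltW.
Qed.

Lemma der_mono f g df dg a b : a <= b ->
  (forall x, a < x < b -> is_derive x 1 f (df x)) ->
  (forall x, a < x < b -> is_derive x 1 g (dg x)) ->
  {within `[a, b], continuous f} -> {within `[a, b], continuous g} ->
  (forall x, a < x < b -> df x <= dg x) -> f b - f a <= g b - g a.
Proof.
move=> ab hf hg cf cg h.
have := @der_ge0_le (fun t => g t - f t) (fun t => dg t - df t) a b ab.
suff -> : (f b - f a <= g b - g a) = (g a - f a <= g b - f b).
  apply.
  - by move=> x xab; apply: derD; [exact: hg|apply: derN; exact: hf].
  - by move=> x; apply: cvgB; [exact: cg|exact: cf].
  - by move=> x xab; rewrite subr_ge0; exact: h.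
by apply/idP/idP => H; lra.
Qed.

Lemma cont_within f a b : (forall x, a <= x <= b -> {for x, continuous f}) ->
  {within `[a, b], continuous f}.
Proof.
move=> h; apply: continuous_in_subspaceT => x.
by rewrite inE /= in_itv /=; exact: h.
Qed.

Lemma cont_eps f x : {for x, continuous f} <->
  (forall e, 0 < e -> exists2 d, 0 < d & forall y, `|y - x| < d -> `|f y - f x| < e).
Proof.
split.
  move=> /cvgrPdist_lt h e e0; have := h e e0.
  move=> /nbhs_ballP [d d0 H]; exists d => // y yd.
  by rewrite distrC; apply: H; rewrite /ball /= distrC.
move=> h; apply/cvgrPdist_lt => e e0; have [d d0 H] := h e e0.
apply/nbhs_ballP; exists d => // y; rewrite /ball /= => yd.
by rewrite distrC; apply: H; rewrite distrC.
Qed.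

(** Since [q] vanishes on the negative half-line, it can be integrated from -oo; the fundamental
    theorem then applies at every point, 0 included, with no one-sided derivatives. *)
Lemma antiderivative q : continuous q -> (forall x, x <= 0 -> q x = 0) ->
  exists Q : R -> R, (forall x, is_derive x 1 Q (q x)) /\ (forall x, x <= 0 -> Q x = 0).
Proof.
move=> cq q0.
pose Q x := (\int[lebesgue_measure]_(t in [set` Interval -oo%O (BRight x)]) (q t))%R.
(* On the half-line up to [u], [q] agrees with its restriction to the compact segment
   [0, max(0, u)]. *)
have I u : lebesgue_measure.-integrable [set` Interval -oo%O (BRight u)] (EFin \o q).
  have i1 : lebesgue_measure.-integrable `[0%R, (Num.max 0 u)] (EFin \o q).
    apply: continuous_compact_integrable; first exact: segment_compact.
    exact: continuous_subspaceT.
  pose mu := @lebesgue_measure R.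
  pose A : set (measurableTypeR R) := [set` Interval -oo%O (BRight u)].
  pose B : set (measurableTypeR R) := [set` `[0, Num.max 0 u]].
  have i2 : mu.-integrable [set: measurableTypeR R] ((EFin \o q) \_ B).
    by apply/integrable_restrict; rewrite ?setTI //; exact: measurable_itv.
  have i3 : mu.-integrable A ((EFin \o q) \_ B).
    by apply: integrableS i2 => //; exact: measurable_itv.
  suff : mu.-integrable A (EFin \o q) by [].
  apply: eq_integrable i3; first exact: measurable_itv.
  move=> x; rewrite inE => xu; rewrite patchE; case: ifPn => //; move: xu.
  rewrite /A /B /= in_itv /= => xu.
  rewrite notin_setE /= in_itv /= => /negP; rewrite negb_and le_max xu orbT orbF -ltNge => x0.
  by rewrite q0 // ltW.
exists Q; split.
  move=> x.
  have xx : x < x + 1 by rewrite ltrDl.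
  have := @continuous_FTC1 R q -oo%O x (x + 1) xx (I _).
  case=> [||h1 h2]; [by rewrite ltEereal /= | exact: cq | ].
  by apply: DeriveDef h1 _; rewrite -h2 derive1E.
move=> x x0; rewrite /Q (@eq_Rintegral _ _ _ _ _ (cst 0)) ?Rintegral_cst ?mul0r //.
by move=> y; rewrite inE /= in_itv /= => yx; rewrite q0 // (le_trans yx).
Qed.
End Calculus.

(** * The radial operator *)

Section RadialOperator.
Local Open Scope classical_set_scope.
Local Open Scope ring_scope.
Context {R : realType}.
Implicit Types (q w y : R -> R) (p : nat) (r : R).

(* w' = y and (r^p w')' = - r^p q.  For p = 2m+1, u = r^m w then satisfies
   (r u')' = m^2 u / r - r^(m+1) q. *)
Definition radial p q w y :=
  [/\ forall r : R, is_derive r 1 w (y r), continuous y &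
      forall r, 0 < r -> is_derive r 1 (fun s => s ^+ p * y s) (- (r ^+ p * q r))].

Lemma radialB p q1 w1 y1 q2 w2 y2 : radial p q1 w1 y1 -> radial p q2 w2 y2 ->
  radial p (fun s => q1 s - q2 s) (fun s => w1 s - w2 s) (fun s => y1 s - y2 s).
Proof.
move=> [a1 b1 c1] [a2 b2 c2]; split.
- by move=> r; apply: derD => //; exact: derN.
- by move=> r; apply: cvgB; [exact: b1|exact: b2].
- move=> r r0; have := derD (c1 r r0) (derN (c2 r r0)).
  rewrite (_ : - _ - - _ = - (r ^+ p * (q1 r - q2 r))); last by ring.
  by congr is_derive; apply/funext => s; ring.
Qed.

Lemma radial_cst p c : radial p (fun=> 0) (fun=> c) (fun=> 0).
Proof.
split.
- by move=> r; exact: der_cst.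
- by move=> r; exact: cvg_cst.
- move=> r _; rewrite mulr0 oppr0.
  rewrite (_ : (fun s => _) = (fun=> 0)); first exact: der_cst.
  by apply/funext => s; rewrite mulr0.
Qed.

Lemma der_exp (l r : R) : is_derive r 1 (fun s => expR (l * s)) (l * expR (l * r)).
Proof.
have h : is_derive r 1 (fun s => l * s) l.
  by have := derM (der_cst r l) (der_id r); rewrite mul0r add0r mulr1.
by have := der_comp h (is_derive_expR (l * r)); rewrite mulrC.
Qed.

(** Two integrations by comparison. The derivative of (K/l) s^p e^(ls) exceeds K s^p e^(ls) by a
    nonnegative term, so the weight s^p cancels and y <= (K/l) e^(ls); integrating once more gives
    the factor 1/l^2. *)
Lemma radial_le p q w y (K l B : R) : (0 < p)%N -> radial p q w y -> 0 <= K -> 0 < l ->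
  (forall r, 0 < r < B -> - q r <= K * expR (l * r)) ->
  forall r, 0 <= r <= B -> w r - w 0 <= K * (expR (l * r) - 1) / l ^+ 2.
Proof.
move=> p0 [hw cy hz] K0 l0 hq r /andP[r0 rB].
have hy (s : R) : 0 < s < r -> y s <= K * expR (l * s) / l.
  move=> /andP[s0 sr].
  have := @der_mono R (fun s => s ^+ p * y s) (fun s => K / l * (s ^+ p * expR (l * s)))
    (fun s => - (s ^+ p * q s))
    (fun s => K / l * (p%:R * s ^+ p.-1 * expR (l * s) + s ^+ p * (l * expR (l * s)))) 0 s (ltW s0).
  rewrite expr0n gtn_eqF //= !(mul0r, mulr0) !subr0.
  have H : s ^+ p * y s <= K / l * (s ^+ p * expR (l * s)) -> y s <= K * expR (l * s) / l.
    have sp : 0 < s ^+ p by rewrite exprn_gt0.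
    rewrite (_ : K / l * _ = s ^+ p * (K * expR (l * s) / l)); last by ring.
    by rewrite ler_pM2l.
  move=> h; apply: H; apply: h.
  - by move=> t /andP[t0 _]; exact: hz.
  - move=> t /andP[t0 _].
    have := derM (der_cst t (K / l)) (derM (derX p (der_id t)) (der_exp l t)).
    by rewrite mul0r add0r mulr1.
  - apply: cont_within => t _; apply: cvgM; [exact: exprn_continuous|exact: cy].
  - apply: cont_within => t _.
    exact: (der_cont (derM (der_cst t (K / l)) (derM (derX p (der_id t)) (der_exp l t)))).
  - move=> t /andP[t0 ts].
    have tB : 0 < t < B by rewrite t0 (lt_le_trans (lt_trans ts sr) rB).
    have h1 : t ^+ p * - q t <= t ^+ p * (K * expR (l * t)).
      by rewrite ler_pM2l ?exprn_gt0 // hq.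
    rewrite -mulrN (le_trans h1) //.
    rewrite (_ : K / l * _ = K / l * (p%:R * t ^+ p.-1 * expR (l * t)) + t ^+ p * (K * expR (l * t))).
      by rewrite lerDr !mulr_ge0 ?invr_ge0 ?expR_ge0 ?exprn_ge0 // ltW.
    by field; rewrite gt_eqF.
have := @der_mono R w (fun s => K / l ^+ 2 * expR (l * s)) y (fun s => K / l ^+ 2 * (l * expR (l * s))) 0 r r0.
rewrite mulr0 expR0 (_ : K / l ^+ 2 * expR (l * r) - K / l ^+ 2 * 1 = K * (expR (l * r) - 1) / l ^+ 2); last by ring.
have hd (t : R) : is_derive t 1 (fun s => K / l ^+ 2 * expR (l * s)) (K / l ^+ 2 * (l * expR (l * t))).
  by have := derM (der_cst t (K / l ^+ 2)) (der_exp l t); rewrite mul0r add0r.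
apply => //.
- by apply: cont_within => t _; exact: der_cont (hw t).
- by apply: cont_within => t _; exact: der_cont (hd t).
- move=> t tr; rewrite (_ : K / l ^+ 2 * (l * expR (l * t)) = K * expR (l * t) / l); first exact: hy.
  by field; rewrite gt_eqF.
Qed.

Lemma radial_bound p q w y (K l B : R) : (0 < p)%N -> radial p q w y -> 0 <= K -> 0 < l ->
  (forall r, 0 < r < B -> `|q r| <= K * expR (l * r)) ->
  forall r, 0 <= r <= B -> `|w r - w 0| <= K * (expR (l * r) - 1) / l ^+ 2.
Proof.
move=> p0 h K0 l0 hq r rB; rewrite ler_norml; apply/andP; split; last first.
  by apply: (radial_le p0 h K0 l0 _ rB) => s sB; rewrite (le_trans _ (hq s sB)) // -normrN ler_norm.
(* The lower bound is the upper bound for [- w], obtained as the zero solution minus [w]. *)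
rewrite lerNl; have h' := radialB (radial_cst p 0) h.
have := radial_le p0 h' K0 l0 _ rB; rewrite !sub0r opprB opprK addrC; apply=> s sB.
by rewrite opprB subr0 (le_trans _ (hq s sB)) // ler_norm.
Qed.

(** Explicitly, y(r) = - r^(-p) times the integral of s^p q over [0, r], and w = 1 plus the integral
    of y. The factor max(0, x)^p extends the integrand continuously by 0, so that w = 1 and y = 0 on
    the negative half-line. *)
Lemma radial_linear p q : (0 < p)%N -> continuous q ->
  exists w y, radial p q w y /\ (forall r, r <= 0 -> w r = 1 /\ y r = 0).
Proof.
move=> p0 cq.
have [Z [hZ Z0]] : exists Z : R -> R, (forall x : R, is_derive x 1 Z (Num.max 0 x ^+ p * q x)) /\
    (forall x, x <= 0 -> Z x = 0).
  apply: (@antiderivative R (fun x => Num.max 0 x ^+ p * q x)).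
    move=> x; apply: cvgM; last exact: cq.
    have cm : continuous (fun t : R => Num.max 0 t).
      by move=> t; apply: (@continuous_max R R (fun=> 0) id); [exact: cvg_cst|exact: cvg_id].
    exact: (cvg_comp _ _ (cm x) (@exprn_continuous R p _)).
  by move=> x x0; rewrite max_l // expr0n gtn_eqF // mul0r.
pose y s := if s <= 0 then 0 else - Z s / s ^+ p.
have y0 r : r <= 0 -> y r = 0 by rewrite /y => ->.
have yE r : 0 < r -> y r = - Z r / r ^+ p by rewrite /y ltNge; case: (r <= 0).
have cy : continuous y.
  move=> x; case: (ltgtP x 0) => x0.
  - have : is_derive x 1 y 0.
      apply: (@der_near _ _ _ _ _ _ (der_cst x 0)).
      by near=> t; rewrite y0 // ltW //; near: t; exact: lt_nbhsl.
    exact: der_cont.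
  - have xp : x ^+ p != 0 by rewrite expf_neq0 // gt_eqF.
    have := derM (derN (hZ x)) (@derV _ (fun s => s ^+ p) x _ xp (derX p (der_id x))) => h.
    apply: der_cont (@der_near _ _ y _ _ _ h).
    by near=> t; rewrite yE //; near: t; exact: lt_nbhsr.
  (* At the singular point, with |q| <= M near 0, the mean value theorem gives |Z s| <= M s^(p+1),
     hence |y s| <= M s. *)
  - rewrite x0; apply/cont_eps => e e0.
    have [d1 d10 hd1] := (cont_eps q 0).1 (cq 0) 1 ltr01.
    pose M := `|q 0| + 1.
    have M0 : 0 < M by rewrite ltr_wpDl.
    exists (Num.min d1 (e / M)); first by rewrite lt_min d10 divr_gt0.
    move=> s; rewrite subr0 (y0 0) // subr0 lt_min => /andP[sd se].
    case: (leP s 0) => s0; first by rewrite y0 // normr0.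
    rewrite gtr0_norm // in sd se.
    rewrite yE // normrM normrN normfV (gtr0_norm (exprn_gt0 _ s0)) ltr_pdivrMr ?exprn_gt0 //.
    have hZ' x' : x' \in `]0, s[ -> is_derive x' 1 Z (Num.max 0 x' ^+ p * q x') by [].
    have [|c] := MVT s0 hZ'.
      by apply: cont_within => t _; exact: der_cont (hZ t).
    rewrite in_itv /= => /andP[c0 cs]; rewrite (Z0 0) // !subr0 => ->.
    rewrite max_r ?(ltW c0) // !normrM (gtr0_norm s0) (gtr0_norm (exprn_gt0 _ c0)).
    have qc : `|q c| <= M.
      have := hd1 c; rewrite subr0 gtr0_norm // (lt_trans cs sd) => /(_ isT) hh.
      have := ler_normD (q c - q 0) (q 0); rewrite subrK /M; lra.
    have cp : c ^+ p <= s ^+ p by rewrite lerXn2r ?nnegrE ?ltW.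
    have h1 : c ^+ p * `|q c| <= s ^+ p * M by rewrite ler_pM // exprn_ge0 // ltW.
    have h2 : c ^+ p * `|q c| * s <= s ^+ p * M * s by rewrite ler_pM2r.
    apply: (le_lt_trans h2); rewrite -mulrA mulrC ltr_pM2r ?exprn_gt0 //.
    by rewrite mulrC -ltr_pdivlMr.
have [W [hW W0]] := antiderivative cy y0.
exists (fun r => 1 + W r), y; split; last by move=> r r0; rewrite W0 // addr0 y0.
split=> //.
- by move=> r; have := derD (der_cst r 1) (hW r); rewrite add0r.
- move=> r r0.
  rewrite (_ : - (r ^+ p * q r) = - (Num.max 0 r ^+ p * q r)); last by rewrite max_r // ltW.
  apply: (@der_near _ _ _ _ _ _ (derN (hZ r))).
  near=> t; have t0 : 0 < t by near: t; exact: lt_nbhsr.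
  by rewrite yE // mulrCA mulfV ?mulr1 // expf_neq0 // gt_eqF.
Unshelve. all: by end_near.
Qed.

Lemma half_pow_small (C e : R) : 0 < e -> exists k : nat, C * 2^-1 ^+ k < e.
Proof.
move=> e0.
have [k hk] : exists k : nat, C / e < k%:R.
  exists (Num.truncn (C / e)).+1; exact: Num.Theory.truncnS_gt.
exists k; rewrite exprVn ltr_pdivrMr ?exprn_gt0 // mulrC -ltr_pdivrMr //.
apply: (lt_le_trans hk); rewrite -natrX ler_nat; exact: ltnW (ltn_expl _ _).
Qed.

(** The intervals of radius C 2^(-k) around u_k are nested; the supremum of their left ends lies in
    all of them, which gives the limit together with its rate. *)
Lemma geometric_limit (u : nat -> R) (C : R) :
  (forall k, `|u k.+1 - u k| <= C * 2^-1 ^+ k.+1) ->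
  exists l, forall k, `|u k - l| <= C * 2^-1 ^+ k.
Proof.
move=> h.
have C0 : 0 <= C.
  have := le_trans (normr_ge0 _) (h 0); rewrite expr1; lra.
pose a k := u k - C * 2^-1 ^+ k; pose b k := u k + C * 2^-1 ^+ k.
have aS k : a k <= a k.+1.
  have := h k; rewrite /a exprS ler_norml => /andP[]; lra.
have bS k : b k.+1 <= b k.
  have := h k; rewrite /b exprS ler_norml => /andP[]; lra.
have am : {homo a : m n / (m <= n)%N >-> m <= n} by apply: homo_leq => //; exact: le_trans.
have bm : {homo b : m n / (m <= n)%N >-> n <= m}.
  by apply: homo_leq => // y x z h1 h2; exact: le_trans h2 h1.
have ab k j : a k <= b j.
  apply: (le_trans (am _ _ (leq_maxl k j))); apply: le_trans (bm _ _ (leq_maxr k j)).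
  have : 0 <= C * 2^-1 ^+ maxn k j by rewrite mulr_ge0 ?exprn_ge0 ?invr_ge0.
  by rewrite /a /b; lra.
have hs : has_sup (range a).
  split; first by exists (a 0), 0%N.
  by exists (b 0) => _ [k _ <-].
exists (sup (range a)) => k.
have h1 : a k <= sup (range a) by apply: ub_le_sup; [exact: hs.2|exists k].
have h2 : sup (range a) <= b k by apply: ge_sup; [exact: hs.1|move=> _ [j _ <-]].
move: h1 h2; rewrite /a /b ler_norml; set s := sup _; move=> *; apply/andP; split; lra.
Qed.
End RadialOperator.

(** * Stability and existence for semilinear radial equations *)

Section Picard.
Local Open Scope classical_set_scope.
Local Open Scope ring_scope.
Context {R : realType}.
Implicit Types (q w y : R -> R) (p : nat) (r : R).

Lemma radial_cont p q w y : radial p q w y -> continuous w.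
Proof. by move=> [hw _ _] x; exact: der_cont (hw x). Qed.

Lemma radial_ext p q1 q2 w y : (forall r, 0 < r -> q1 r = q2 r) ->
  radial p q1 w y -> radial p q2 w y.
Proof. by move=> e [a b c]; split=> // r r0; rewrite -e //; exact: c. Qed.

(** A Gronwall estimate. Let M be the maximum of |w1 - w2| e^(-ls) on [0, B]. As l^2 = 2L,
    [radial_bound] gives 2LM <= LM + e, so M <= e/L; inserting this into the same bound yields the
    claim. *)
Lemma radial_stable p q1 w1 y1 q2 w2 y2 (L e B : R) : (0 < p)%N ->
  radial p q1 w1 y1 -> radial p q2 w2 y2 -> w1 0 = w2 0 -> 0 < L -> 0 <= e ->
  (forall r, 0 < r < B -> `|q1 r - q2 r| <= L * `|w1 r - w2 r| + e) ->
  forall r, 0 <= r <= B ->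
    `|w1 r - w2 r| <= e / L * (expR (Num.sqrt (2 * L) * r) - 1).
Proof.
move=> p0 h1 h2 h0 L0 e0 hq r /andP[r0 rB].
have B0 := le_trans r0 rB.
set l := Num.sqrt (2 * L).
have l0 : 0 < l by rewrite sqrtr_gt0 mulr_gt0.
have l2 : l ^+ 2 = 2 * L by rewrite sqr_sqrtr // mulr_ge0 // ltW.
have h := radialB h1 h2.
have cf : {within `[0, B], continuous (fun s => `|w1 s - w2 s| * expR (- l * s))}.
  apply: cont_within => t _; apply: cvgM; last exact: der_cont (der_exp (- l) t).
  by apply: cvg_norm; exact: radial_cont h t.
have [c] := EVT_max B0 cf; rewrite in_itv /= => /andP[c0 cB] hc.
set M := `|w1 c - w2 c| * expR (- l * c) in hc.
have M0 : 0 <= M by rewrite mulr_ge0 ?expR_ge0.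
have hM s : 0 <= s <= B -> `|w1 s - w2 s| <= M * expR (l * s).
  move=> sB; have := hc s; rewrite in_itv /= => /(_ sB).
  by rewrite mulNr expRN ler_pdivrMr ?expR_gt0.
have e1 s : 0 <= s -> 1 <= expR (l * s).
  by move=> s0; rewrite -expR0 ler_expR mulr_ge0 // ltW.
have hq' K : 0 <= K -> M <= K -> forall s, 0 < s < B ->
    `|q1 s - q2 s| <= (L * K + e) * expR (l * s).
  move=> K0 MK s /andP[s0 sB]; apply: (le_trans (hq s _)); first by rewrite s0.
  have h3 : `|w1 s - w2 s| <= K * expR (l * s).
    by apply: (le_trans (hM s _)); rewrite ?(ltW s0) ?(ltW sB) // ler_wpM2r ?expR_ge0.
  have h4 := ler_wpM2l (ltW L0) h3.
  have h5 := ler_wpM2l e0 (e1 s (ltW s0)).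
  by rewrite mulrDl; lra.
have main K s : 0 <= K -> M <= K -> 0 <= s <= B ->
    `|w1 s - w2 s| <= (L * K + e) * (expR (l * s) - 1) / l ^+ 2.
  move=> K0 MK sB.
  have := radial_bound p0 h _ l0 (hq' K K0 MK) sB.
  by rewrite h0 subrr subr0; apply; rewrite addr_ge0 // mulr_ge0 // ltW.
have ML : M <= e / L.
  have cB' : 0 <= c <= B by rewrite c0.
  have h3 := main M c M0 (lexx _) cB'.
  have h4 : M * expR (l * c) = `|w1 c - w2 c|.
    by rewrite /M mulNr expRN mulfVK // gt_eqF // expR_gt0.
  rewrite -h4 l2 ler_pdivlMr ?mulr_gt0 // in h3.
  have h5 := e1 c c0.
  have h6 : 0 <= L * M + e by rewrite addr_ge0 // mulr_ge0 // ltW.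
  rewrite ler_pdivlMr //.
  have h7 : (M * (2 * L)) * expR (l * c) <= (L * M + e) * expR (l * c) by move: h3; lra.
  by move: h7; rewrite ler_pM2r ?expR_gt0 //; lra.
have rB' : 0 <= r <= B by rewrite r0.
have eL0 : 0 <= e / L by rewrite divr_ge0 // ltW.
have := main (e / L) r eL0 ML rB'.
rewrite l2 (_ : (L * (e / L) + e) * _ / _ = e / L * (expR (l * r) - 1)) //.
by field; rewrite gt_eqF.
Qed.

(* Picard iteration in the weighted norm sup |w r| exp (- l r) with l^2 = 2 L,
   for which the integral operator contracts by a factor 1/2. *)
Lemma radial_solution p (G : R -> R -> R) (L : R) : (0 < p)%N -> 0 < L ->
  (forall w, continuous w -> continuous (fun s => G s (w s))) ->
  (forall s a b, `|G s a - G s b| <= L * `|a - b|) ->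
  (forall s, G s 0 = 0) ->
  exists w y, radial p (fun s => G s (w s)) w y /\ w 0 = 1 /\ y 0 = 0.
Proof.
move=> p0 L0 Gc GL G0.
(* [T] is the solution operator of the linear problem; its value at a discontinuous [q] is a
   dummy. *)
have /choice [T hT] : forall q, exists wy : (R -> R) * (R -> R), continuous q ->
    radial p q wy.1 wy.2 /\ (forall r, r <= 0 -> wy.1 r = 1 /\ wy.2 r = 0).
  move=> q; have [cq|ncq] := pselect (continuous q); last by exists (q, q).
  by have [w [y h]] := radial_linear p0 cq; exists (w, y).
pose N w := fun s => G s (w s).
pose W k := iter k (fun w => (T (N w)).1) (fun=> 1).
set l := Num.sqrt (2 * L).
have l0 : 0 < l by rewrite sqrtr_gt0 mulr_gt0.
have l2 : l ^+ 2 = 2 * L by rewrite sqr_sqrtr // mulr_ge0 // ltW.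
have Wc k : continuous (W k).
  elim: k => [|k IH]; first exact: cst_continuous.
  by have [h _] := hT _ (Gc _ IH); exact: radial_cont h.
have Wr k : radial p (N (W k)) (W k.+1) (T (N (W k))).2 by case: (hT _ (Gc _ (Wc k))).
have W1 k r : r <= 0 -> W k r = 1.
  by case: k => // k r0; have [_ h] := hT _ (Gc _ (Wc k)); case: (h r r0).
(* The contraction: a weighted distance K between inputs becomes K/2 between outputs, because L K /
   l^2 = K/2. *)
have ct w1 y1 w2 y2 q1 q2 (K : R) : 0 <= K -> radial p q1 w1 y1 -> radial p q2 w2 y2 ->
    (forall r, r <= 0 -> w1 r = 1 /\ w2 r = 1) ->
    (forall r, 0 < r -> `|q1 r - q2 r| <= L * K * expR (l * r)) ->
    forall r, `|w1 r - w2 r| <= K / 2 * expR (l * r).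
  move=> K0 h1 h2 h3 h4 r; case: (leP r 0) => r0.
    by have [-> ->] := h3 r r0; rewrite subrr normr0 mulr_ge0 ?divr_ge0 ?expR_ge0.
  have h5 := radialB h1 h2.
  have LK : 0 <= L * K by rewrite mulr_ge0 // ltW.
  have := @radial_bound R p _ _ _ (L * K) l r p0 h5 LK l0 _ r.
  have [-> ->] := h3 0 (lexx _); rewrite subrr subr0 lexx ltW //= => h6.
  apply: (le_trans (h6 _ isT)); first by move=> s /andP[s0 _]; exact: h4.
  rewrite l2 (_ : L * K * _ / _ = K / 2 * (expR (l * r) - 1)); last by field; rewrite gt_eqF.
  by rewrite ler_wpM2l ?divr_ge0 // gerBl.
have dW k r : `|W k.+1 r - W k r| <= expR (l * r) * 2^-1 ^+ k.+1.
  rewrite [X in _ <= X]mulrC.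
  elim: k r => [|k IH] r.
    (* The first iterate is compared with the constant 1, using |G(s, 1)| <= L <= L e^(ls). *)
    have := ct _ _ _ _ _ _ 1 ler01 (Wr 0%N) (radial_cst p 1).
    rewrite expr1 mul1r; apply.
      by move=> s s0; rewrite W1.
    move=> s s0; rewrite subr0 mulr1 /N -[G s _]subr0 -(G0 s) (le_trans (GL _ _ _)) //.
    by rewrite subr0 normr1 ler_wpM2l ?(ltW L0) // -expR0 ler_expR mulr_ge0 ?ltW.
  have := ct _ _ _ _ _ _ (2^-1 ^+ k.+1) _ (Wr k.+1) (Wr k).
  rewrite [2^-1 ^+ k.+2]exprSr; apply; first by rewrite exprn_ge0 ?invr_ge0.
    by move=> s s0; rewrite !W1.
  by move=> s s0; rewrite (le_trans (GL _ _ _)) // -mulrA ler_wpM2l // ltW.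
have /choice [w hw] : forall r, exists a, forall k, `|W k r - a| <= expR (l * r) * 2^-1 ^+ k.
  by move=> r; exact: geometric_limit.
have sq r (a b : R) : (forall k, `|a - b| <= 2 * expR (l * r) * 2^-1 ^+ k) -> a = b.
  move=> h; apply/eqP/negPn/negP => ne.
  have pos : 0 < `|a - b| by rewrite normr_gt0 subr_eq0.
  have [k hk] := half_pow_small (2 * expR (l * r)) pos.
  by have := h k; rewrite leNgt hk.
(* The error e^(ls) 2^(-k) is uniform for s <= r + 1, so continuity passes to the limit. *)
have cw : continuous w.
  move=> r; apply/cont_eps => e e0.
  have e3 : 0 < e / 3 by rewrite divr_gt0.
  have [k hk] := half_pow_small (expR (l * (r + 1))) e3.
  have [d d0 hd] := (cont_eps _ _).1 (Wc k r) _ e3.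
  have close s : s <= r + 1 -> `|W k s - w s| < e / 3.
    move=> sr; apply: le_lt_trans hk; apply: (le_trans (hw s k)).
    by rewrite ler_wpM2r ?exprn_ge0 ?invr_ge0 // ler_expR ler_pM2l.
  exists (Num.min d 1); first by rewrite lt_min d0 ltr01.
  move=> s; rewrite lt_min => /andP[sd s1].
  have sr : s <= r + 1 by move: s1; rewrite ltr_norml => /andP[]; lra.
  have rr : r <= r + 1 by lra.
  have := close s sr; have := close r rr; have := hd s sd.
  rewrite !ltr_norml => /andP[? ?] /andP[? ?] /andP[? ?]; apply/andP; split; lra.
have [hv v1] := hT _ (Gc _ cw).
have w1 r : r <= 0 -> w r = 1.
  move=> r0; apply: (sq r) => k; have := hw r k; rewrite W1 // distrC.
  move=> /le_trans; apply; rewrite ler_wpM2r ?exprn_ge0 ?invr_ge0 //.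
  have := expR_ge0 (l * r); lra.
(* Both sides are within a multiple of e^(lr) 2^(-k) of the iterate [W k.+1], so [w] is a fixed
   point. *)
have vw : (T (N w)).1 = w.
  apply/funext => r; apply: (sq r) => k.
  have h1 : `|(T (N w)).1 r - W k.+1 r| <= 2^-1 ^+ k / 2 * expR (l * r).
    apply: (ct _ _ _ _ _ _ _ _ hv (Wr k)); first by rewrite exprn_ge0 ?invr_ge0.
      by move=> s s0; rewrite W1 //; case: (v1 s s0).
    move=> s s0; rewrite (le_trans (GL _ _ _)) // -mulrA ler_wpM2l ?(ltW L0) // distrC mulrC.
    exact: hw.
  have h2 := hw r k.+1; rewrite exprS in h2.
  have := ler_normD ((T (N w)).1 r - W k.+1 r) (W k.+1 r - w r).
  rewrite subrKA; set P := _ ^+ k in h1 h2 *.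
  have : 0 <= P * expR (l * r) by rewrite mulr_ge0 ?expR_ge0 ?exprn_ge0 ?invr_ge0.
  lra.
exists w, (T (N w)).2; split; first by rewrite -{2}vw.
by rewrite w1 //; case: (v1 0 (lexx _)).
Qed.
End Picard.

(** * The Bessel function J_0 *)

Section Bessel.
Local Open Scope classical_set_scope.
Local Open Scope ring_scope.
Context {R : realType}.

Lemma pseries_cvg_fact (c : nat -> R) (x : R) :
  (forall k, `|c k| <= (k`!%:R)^-1) -> cvgn (pseries c x).
Proof.
move=> hc; apply: normed_cvg.
apply: series_le_cvg (is_cvg_series_exp_coeff `|x|) => k.
- exact: normr_ge0.
- by rewrite divr_ge0 ?exprn_ge0.
- by rewrite /= normrM normrX mulrC ler_wpM2l ?exprn_ge0.
Qed.

Definition bessel_coeff (k : nat) : R := (-1) ^+ k / (k`!%:R) ^+ 2.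

(** The recurrence (k+1)^2 c_(k+1) = - c_k, which is the equation t B'' + B' = - B read on the
    coefficients of B. *)
Lemma bessel_coeff_diffs k :
  k.+1%:R * pseries_diffs bessel_coeff k = - bessel_coeff k.
Proof.
rewrite /pseries_diffs /bessel_coeff factS natrM exprS.
have h1 : k.+1%:R != 0 :> R by rewrite pnatr_eq0.
have h2 : k`!%:R != 0 :> R by rewrite pnatr_eq0 -lt0n fact_gt0.
by field; rewrite h2 nat1r.
Qed.

Lemma besselJ0E (x : R) : besselJ0 x = limn (pseries bessel_coeff ((x / 2) ^+ 2)).
Proof.
rewrite /besselJ0 /pseries /series /=; congr (limn _); apply/funext => N.
rewrite big_mkord; apply: eq_bigr => k _.
by rewrite /bessel_coeff exprM; ring.
Qed.

Lemma besselJ0_0 : besselJ0 (0 : R) = 1.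
Proof.
rewrite besselJ0E mul0r expr0n /=; apply/cvg_lim => //.
apply: cvg_near_cst; near=> n.
have n0 : (0 < n)%N by near: n; exists 1%N.
rewrite /pseries /series /= -(prednK n0) big_nat_recl //= big1 ?addr0.
  by rewrite /bessel_coeff expr0 fact0 expr1n invr1 !mulr1.
by move=> i _; rewrite expr0n /= mulr0.
Unshelve. all: by end_near.
Qed.

Lemma fact_inv_ge (k : nat) : (0 : R) < k`!%:R /\ (1 : R) <= k`!%:R.
Proof. by rewrite ltr0n ler1n fact_gt0. Qed.

(** Write J_0(x) = B(x^2/4). Then t B'' + B' = - B becomes Bessel's equation (x J_0')' = - x J_0,
    with J_0' = (x/2) B'(x^2/4). *)
Lemma besselJ0_radial : exists y : R -> R, radial 1 besselJ0 besselJ0 y.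
Proof.
pose c := bessel_coeff; pose d := pseries_diffs c; pose e := pseries_diffs d.
have cE k : `|c k| = (k`!%:R)^-1 ^+ 2.
  by rewrite /c /bessel_coeff normrM normrX normrN1 expr1n mul1r normfV normrX normr_nat exprVn.
have dE k : `|d k| = (k`!%:R)^-1 / k.+1`!%:R.
  rewrite /d /pseries_diffs normrM cE normr_nat factS natrM.
  have [h _] := fact_inv_ge k.
  by field; rewrite (gt_eqF h) nat1r pnatr_eq0.
have eE k : `|e k| = (k`!%:R)^-1 / k.+2`!%:R.
  rewrite /e /pseries_diffs normrM dE normr_nat (factS k) natrM.
  have [h _] := fact_inv_ge k; have [h' _] := fact_inv_ge k.+2.
  by field; rewrite (gt_eqF h) (gt_eqF h') nat1r pnatr_eq0.
have le1 k j : (k`!%:R)^-1 / j`!%:R <= (k`!%:R)^-1 :> R.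
  have [h _] := fact_inv_ge k; have [h' h1] := fact_inv_ge j.
  by rewrite ler_pdivrMr // ler_peMr // invr_ge0 ltW.
have cc x : cvgn (pseries c x) by apply: pseries_cvg_fact => k; rewrite cE expr2 le1.
have cd x : cvgn (pseries d x) by apply: pseries_cvg_fact => k; rewrite dE le1.
have ce x : cvgn (pseries e x) by apply: pseries_cvg_fact => k; rewrite eE le1.
pose B x := limn (pseries c x); pose B1 x := limn (pseries d x); pose B2 x := limn (pseries e x).
have cf x : cvgn (pseries (pseries_diffs e) x).
  apply: pseries_cvg_fact => k; rewrite /pseries_diffs normrM eE normr_nat (factS k) natrM.
  have [h _] := fact_inv_ge k; have [h' h1] := fact_inv_ge k.+3.
  rewrite [X in X <= _](_ : _ = (k`!%:R)^-1 / k.+3`!%:R) ?le1 //.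
  by field; rewrite (gt_eqF h) (gt_eqF h') nat1r pnatr_eq0.
have hB x : is_derive (x : R) 1 B (B1 x).
  apply: (@pseries_snd_diffs _ _ (`|x| + 1)); [exact: cc|exact: cd|exact: ce|].
  by rewrite [X in _ < X]ger0_norm ?addr_ge0 // ltrDl.
have hB1 x : is_derive (x : R) 1 B1 (B2 x).
  apply: (@pseries_snd_diffs _ _ (`|x| + 1)); [exact: cd|exact: ce|exact: cf|].
  by rewrite [X in _ < X]ger0_norm ?addr_ge0 // ltrDl.
(* The identity holds already for partial sums, term by term; the shift of x^(i-1) to x^i is
   harmless since the term i = 0 vanishes. *)
have ode x : x * B2 x + B1 x = - B x.
  have h1 := pseries_diffs_equiv (ce x).
  have h2 : series (fun i => i%:R * d i * x ^+ i) @ \oo --> x * B2 x.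
    suff -> : series (fun i => i%:R * d i * x ^+ i) =
        fun n => x * series (fun i => i%:R * d i * x ^+ i.-1) n.
      by apply: cvgM h1; exact: cvg_cst.
    apply/funext => n; rewrite /series /= mulr_sumr; apply: eq_bigr => -[|i] _.
      by rewrite !mul0r mulr0.
    by rewrite exprS /=; ring.
  have h3 := cvgD h2 (cd x).
  have h4 := cvgN (cc x).
  have /= l3 := cvg_lim (@Rhausdorff R) (h3 _); have /= l4 := cvg_lim (@Rhausdorff R) (h4 _).
  transitivity (limn (series (fun i => i%:R * d i * x ^+ i) + pseries d x)); first by rewrite -l3.
  transitivity (limn (- pseries c x)); last by rewrite -l4.
  congr (limn _).
  apply/funext => n; rewrite /pseries /series !fctE /= -sumrN -big_split /=.
  apply: eq_bigr => i _.
  by rewrite -mulNr -bessel_coeff_diffs -/d -natr1; ring.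
pose s x := (x / 2) ^+ 2 : R.
have hs x : is_derive (x : R) 1 s (x / 2).
  have := derX 2 (derM (der_id x) (der_cst x 2^-1)).
  by rewrite (_ : _ * _ = x / 2) //= expr1; lra.
have JE : besselJ0 = fun x => B (s x) by apply/funext => x; rewrite besselJ0E.
have hy x := derM (derM (der_id x) (der_cst x 2^-1)) (der_comp (hs x) (hB1 _)).
exists (fun x => x / 2 * B1 (s x)); split.
- move=> x; rewrite JE; have := der_comp (hs x) (hB _); by rewrite mulrC.
- by move=> x; exact: der_cont (hy x).
- move=> x x0; have := derM (derX 1 (der_id x)) (hy x).
  rewrite JE -[B (s x)]opprK -ode /s.
  by congr is_derive; rewrite !expr1 /=; field.
Qed.
End Bessel.

(** * Zeros *)

Section Zeros.
Local Open Scope classical_set_scope.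
Local Open Scope ring_scope.
Context {R : realType}.
Implicit Types (f q w y : R -> R) (p m : nat) (r : R).

Lemma der_gt0_lt f (df : R -> R) (a b : R) : a < b ->
  (forall x, a < x < b -> is_derive x 1 f (df x)) ->
  {within `[a, b], continuous f} ->
  (forall x, a < x < b -> 0 < df x) -> f a < f b.
Proof.
move=> ab hf cf h.
have hf' x : x \in `]a, b[ -> is_derive x 1 f (df x) by rewrite in_itv /=; exact: hf.
have [c] := MVT ab hf' cf; rewrite in_itv /= => cab e.
by rewrite -subr_gt0 e mulr_gt0 ?h // subr_gt0.
Qed.

Lemma cont_pos_near f r : {for r, continuous f} -> 0 < f r ->
  exists2 d, 0 < d & forall s, `|s - r| < d -> 0 < f s.
Proof.
move=> /cont_eps h fr; have [d d0 hd] := h _ fr; exists d => // s /hd.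
by rewrite ltr_norml => /andP[+ _]; lra.
Qed.

(** The zero is the supremum of the x such that f > 0 on [0, x]. A positive value there would let
    the interval grow, a negative one would spread to smaller points. *)
Lemma first_zero f (B : R) : continuous f -> 0 < f 0 ->
  (exists2 r, 0 <= r <= B & f r <= 0) ->
  exists r1, [/\ 0 < r1, r1 <= B, f r1 = 0 & forall s, 0 <= s < r1 -> 0 < f s].
Proof.
move=> cf f0 [r /andP[r0 rB] fr].
pose A := [set x : R | 0 <= x <= r /\ forall s, 0 <= s <= x -> 0 < f s].
have A0 : A 0.
  split; first by rewrite lexx.
  by move=> s sx; rewrite (_ : s = 0) //; apply/le_anti; rewrite andbC.
have hs : has_sup A by split; [exists 0|exists r => x [/andP[]]].
set r1 := sup A.
have r1r : r1 <= r by apply: ge_sup; [exists 0|move=> x [/andP[]]].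
have r10 : 0 <= r1 by apply: ub_le_sup => //; case: hs.
have pos s : 0 <= s < r1 -> 0 < f s.
  move=> /andP[s0 s1]; have d0 : 0 < r1 - s by rewrite subr_gt0.
  have [x [_ hx] sx] := sup_adherent d0 hs.
  by apply: hx; rewrite s0 /=; move: sx; rewrite -/r1; lra.
have npos : ~ 0 < f r1.
  move=> h; have [d d0 hd] := cont_pos_near (cf r1) h.
  have [rr1|r1r'] := eqVneq r1 r; first by move: h; rewrite rr1 ltNge fr.
  have lt1 : r1 < r by rewrite lt_def eq_sym r1r' r1r.
  pose t := Num.min r (r1 + d / 2).
  have t1 : r1 < t by rewrite lt_min lt1 ltrDl divr_gt0.
  have : A t.
    split; first by rewrite (le_trans r10 (ltW t1)) ge_min lexx.
    move=> s /andP[s0 st]; case: (ltP s r1) => s1; first by apply: pos; rewrite s0.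
    apply: hd; rewrite ger0_norm ?subr_ge0 //.
    have : s <= r1 + d / 2 by apply: le_trans st _; rewrite ge_min lexx orbT.
    lra.
  by move=> At; have := ub_le_sup hs.2 At; rewrite -/r1 leNgt t1.
have fr1 : f r1 = 0.
  apply/eqP/negPn/negP => ne.
  have neg : 0 < - f r1 by rewrite oppr_gt0 lt_def eq_sym ne leNgt; apply/negP.
  have [d d0 hd] := @cont_pos_near (fun t => - f t) r1 (cvgN (cf r1)) neg.
  have [rr1|r1r'] := eqVneq r1 0; first by move: neg; rewrite rr1; lra.
  have lt1 : 0 < r1 by rewrite lt_def r1r' r10.
  pose t := Num.max 0 (r1 - d / 2).
  have t1 : t < r1 by rewrite gt_max lt1 gtrDl oppr_lt0 divr_gt0.
  have t2 : r1 - d / 2 <= t by rewrite le_max lexx orbT.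
  have := hd t; rewrite ltr0_norm ?subr_lt0 // => /(_ _) h.
  have {}h : 0 < - f t by apply: h; lra.
  have := pos t; rewrite t1 le_max lexx /= => /(_ isT); lra.
exists r1; split=> //; last exact: le_trans rB.
rewrite lt_def r10 andbT; apply/eqP => e; have e2 : f 0 = f r1 by rewrite e.
by move: f0; rewrite e2 fr1 ltxx.
Qed.

(** With a positive slope at [r1], f would increase strictly to 0 just before [r1] and be negative
    there. *)
Lemma slope_first_zero f (df : R -> R) r1 : 0 < r1 ->
  (forall r, is_derive r 1 f (df r)) -> continuous df ->
  f r1 = 0 -> (forall s, 0 <= s < r1 -> 0 <= f s) -> df r1 <= 0.
Proof.
move=> r10 hf cdf f1 pos; rewrite leNgt; apply/negP => h.
have [d d0 hd] := cont_pos_near (cdf r1) h.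
pose t := Num.max 0 (r1 - d / 2).
have t1 : t < r1 by rewrite gt_max r10 gtrDl oppr_lt0 divr_gt0.
have t2 : r1 - d / 2 <= t by rewrite le_max lexx orbT.
have : f t < f r1.
  apply: (@der_gt0_lt f df) => //.
  - by apply: cont_within => x _; exact: der_cont (hf x).
  - move=> x /andP[tx xr]; apply: hd; rewrite ltr0_norm ?subr_lt0 //; lra.
by rewrite f1 ltNge pos // t1 le_max lexx.
Qed.

Lemma radial_dy p q w y r : radial p q w y -> 0 < r ->
  is_derive r 1 y (- q r - p%:R / r * y r).
Proof.
move=> [_ _ h] r0.
have rp : r ^+ p != 0 by rewrite expf_neq0 // gt_eqF.
have h1 := derM (h r r0) (@derV _ (fun s => s ^+ p) r _ rp (derX p (der_id r))).
rewrite (_ : - q r - _ = - (r ^+ p * q r) / r ^+ p +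
  r ^+ p * y r * (- (p%:R * r ^+ p.-1 * 1) / (r ^+ p) ^+ 2)).
  apply: (@der_near _ _ _ _ _ _ h1); near=> t.
  have t0 : 0 < t by near: t; exact: lt_nbhsr.
  by rewrite mulrAC mulfV ?mul1r // expf_neq0 // gt_eqF.
case: p rp {h h1} => [|p] rp; first by rewrite expr0 !mul0r oppr0; field.
rewrite exprS /=; field; rewrite expf_neq0 ?gt_eqF //.
Unshelve. all: by end_near.
Qed.

(* The second function is r u' for u = r^m w. *)
Lemma polar_der m q w y r : radial m.*2.+1 q w y -> 0 < r ->
  is_derive r 1 (fun s => s ^+ m * w s) ((m%:R * r ^+ m * w r + r ^+ m.+1 * y r) / r) /\
  is_derive r 1 (fun s => m%:R * s ^+ m * w s + s ^+ m.+1 * y s)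
    (m%:R ^+ 2 / r * (r ^+ m * w r) - r ^+ m.+1 * q r).
Proof.
move=> h r0; have [hw _ _] := h; have hy := radial_dy h r0.
have rm : r ^+ m.-1 * (m%:R * r) = m%:R * r ^+ m.
  by case: m {h hy} => [|k]; rewrite ?mul0r ?mulr0 // exprSr /=; ring.
have rm' : m%:R * r ^+ m.-1 = m%:R * r ^+ m / r.
  by rewrite -rm; field; rewrite gt_eqF.
split.
- have := derM (derX m (der_id r)) (hw r).
  by congr is_derive; rewrite rm' exprS; field; rewrite gt_eqF.
- have := derD (derM (derM (der_cst r m%:R) (derX m (der_id r))) (hw r)) (derM (derX m.+1 (der_id r)) hy).
  congr is_derive; rewrite rm' /= exprS -!natr1 -mul2n natrM; field; rewrite gt_eqF //.
Qed.

Lemma polar_cont m q w y : radial m.*2.+1 q w y ->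
  continuous (fun s : R => s ^+ m * w s) /\
  continuous (fun s : R => m%:R * s ^+ m * w s + s ^+ m.+1 * y s).
Proof.
move=> h; have cw := radial_cont h; have [_ cy _] := h; split=> x.
  by apply: cvgM; [exact: exprn_continuous|exact: cw].
apply: cvgD; apply: cvgM; [|exact: cw|exact: exprn_continuous|exact: cy].
by apply: cvgM; [exact: cvg_cst|exact: exprn_continuous].
Qed.

(* Gronwall backwards from r1 for the energy w^2 + y^2. *)
Lemma no_double_zero p q w y (L r1 : R) : radial p q w y -> w 0 = 1 -> 0 <= L ->
  (forall r, 0 < r -> `|q r| <= L * `|w r|) -> 0 < r1 -> w r1 = 0 -> y r1 <> 0.
Proof.
move=> h w0 L0 hq r10 w1 y1; have [hw cy _] := h; have cw := radial_cont h.
have [d d0 hd] : exists2 d, 0 < d & forall s, `|s - 0| < d -> 0 < w s.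
  by apply: cont_pos_near; [exact: cw|rewrite w0].
(* The point [a] has w(a) > 0 and keeps away from the singularity: p/s <= p/a on [a, r1]. *)
pose a := Num.min (d / 2) (r1 / 2).
have a0 : 0 < a by rewrite lt_min !divr_gt0.
have a1 : a < r1 by rewrite gt_min (_ : r1 / 2 < r1) ?orbT //; lra.
have wa : 0 < w a.
  apply: hd; rewrite subr0 gtr0_norm // gt_min (_ : d / 2 < d) //; lra.
(* The three terms absorb 2wy, 2qy and 2(p/s)y^2 in the derivative of the energy, so [F] is
   nondecreasing; yet F(a) > 0 = F(r1) at a double zero. *)
pose K := 1 + L + 2 * p%:R / a.
pose F s := (w s * w s + y s * y s) * expR (K * s).
have hF s : a < s < r1 -> is_derive s 1 F
  ((y s * w s + w s * y s + ((- q s - p%:R / s * y s) * y s + y s * (- q s - p%:R / s * y s))) * expR (K * s)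
   + (w s * w s + y s * y s) * (K * expR (K * s))).
  move=> /andP[sa _]; have s0 := lt_trans a0 sa; have hy := radial_dy h s0.
  exact: derM (derD (derM (hw s) (hw s)) (derM hy hy)) (der_exp K s).
have : F a <= F r1.
  apply: (der_ge0_le (ltW a1) hF).
    apply: cont_within => s _; apply: cvgM; last exact: der_cont (der_exp K s).
    by apply: cvgD; apply: cvgM; try exact: cw; exact: cy.
  move=> s /andP[sa _]; have s0 := lt_trans a0 sa.
  rewrite mulrA -mulrDl mulr_ge0 ?expR_ge0 //.
  have e1 : 2 * (p%:R / s * (y s * y s)) <= 2 * (p%:R / a) * (y s * y s).
    rewrite -[X in _ <= X]mulrA ler_pM2l // ler_wpM2r -?expr2 ?sqr_ge0 //.
    by rewrite ler_wpM2l ?ler0n // lef_pV2 ?posrE // ltW.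
  have e2 : `|q s * y s| <= L * (`|w s| * `|y s|).
    by rewrite normrM mulrA ler_wpM2r // hq.
  have e3 : 2 * (`|w s| * `|y s|) <= w s * w s + y s * y s.
    rewrite -!expr2 -[w s ^+ 2]real_normK ?num_real // -[y s ^+ 2]real_normK ?num_real //.
    have := sqr_ge0 (`|w s| - `|y s|); rewrite sqrrB; lra.
  have e4 : L * (2 * (`|w s| * `|y s|)) <= L * (w s * w s + y s * y s) by rewrite ler_wpM2l.
  have e5 : - (`|w s| * `|y s|) <= w s * y s by rewrite -normrM lerNl -normrN ler_norm.
  have e6 := ler_norm (q s * y s).
  have e7 : 0 <= 2 * (p%:R / a) * (w s * w s).
    by rewrite -expr2 mulr_ge0 ?sqr_ge0 // mulr_ge0 // divr_ge0 ?ler0n ?(ltW a0).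
  rewrite /K -[2 * p%:R / a]mulrA; move: e1 e2 e3 e4 e5 e6 e7.
  set P := p%:R / s; set Q := p%:R / a; nra.
rewrite /F w1 y1 !mul0r addr0 mul0r leNgt => /negP; apply.
by rewrite mulr_gt0 ?expR_gt0 // ltr_pwDl ?mulr_gt0 // -expr2 sqr_ge0.
Qed.
End Zeros.

(** * Comparison arguments *)

Section Comparison.
Local Open Scope classical_set_scope.
Local Open Scope ring_scope.
Context {R : realType}.
Implicit Types (f q w y : R -> R) (p m : nat) (r : R).

(** As J_0(0) = 1, a nonpositive value at [r] would force a zero in (0, r], before [r0]. *)
Lemma besselJ0_pos r0 r : first_pos_zero_J0 r0 -> 0 <= r < r0 -> 0 < besselJ0 r.
Proof.
move=> [r00 [_ hr]] /andP[rge rlt]; have [y hJ] := @besselJ0_radial R.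
rewrite ltNge; apply/negP => le0.
have [||r1 [r10 r1r e _]] := @first_zero R besselJ0 r (radial_cont hJ).
- by rewrite besselJ0_0.
- by exists r => //; rewrite rge lexx.
by have := hr r1; rewrite r10 (le_lt_trans r1r rlt) e eqxx => /(_ isT).
Qed.

(* Wronskian of r^m w with J0 (r0 r / Rad), using m^2 / r^2 >= m^2 / Rad^2. *)
Lemma linear_positive m (r0 Rad a : R) w y : (0 < m)%N -> first_pos_zero_J0 r0 -> 0 < Rad ->
  a < (m%:R ^+ 2 + r0 ^+ 2) / Rad ^+ 2 ->
  radial m.*2.+1 (fun s => a * w s) w y -> w 0 = 1 ->
  forall r, 0 <= r <= Rad -> 0 < w r.
Proof.
move=> m0 hr0 Rad0 ha h w0 r rB; rewrite ltNge; apply/negP => wr.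
have [r00 [Jr0 _]] := hr0.
have [||r1 [r10 r1r wr1 wpos]] := @first_zero R w Rad (radial_cont h).
- by rewrite w0.
- by exists r.
have [Jp hJ] := @besselJ0_radial R; have [hJ1 cJp hJ2] := hJ; have [hw cy _] := h.
have yr1 : y r1 <= 0 by apply: (slope_first_zero r10 hw cy wr1) => s sr; exact/ltW/wpos.
pose k := r0 / Rad.
have k0 : 0 < k by rewrite divr_gt0.
have hk s : is_derive (s : R) 1 (fun t => k * t) k.
  by have := derM (der_cst s k) (der_id s); rewrite mul0r add0r mulr1.
have hphi s : is_derive (s : R) 1 (fun t => besselJ0 (k * t)) (Jp (k * s) * k).
  exact: der_comp (hk s) (hJ1 _).
have hpsi (s : R) : 0 < s -> is_derive s 1 (fun t => k * t * Jp (k * t)) (- (k * s * besselJ0 (k * s)) * k).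
  move=> s0; have ks0 : 0 < k * s by rewrite mulr_gt0.
  have := der_comp (hk s) (hJ2 _ ks0); rewrite expr1.
  by congr is_derive.
have phipos s : 0 <= s < Rad -> 0 < besselJ0 (k * s).
  move=> /andP[s0 sR]; apply: besselJ0_pos hr0 _.
  by rewrite mulr_ge0 ?(ltW k0) //= /k mulrAC ltr_pdivrMr // ltr_pM2l.
have phi1 : 0 <= besselJ0 (k * r1).
  move: r1r; rewrite le_eqVlt => /orP[/eqP -> |r1R]; first by rewrite /k divfK ?Jr0 // gt_eqF.
  by rewrite ltW // phipos // r1R ltW.
pose u s := s ^+ m * w s; pose z s := m%:R * s ^+ m * w s + s ^+ m.+1 * y s.
pose phi s := besselJ0 (k * s); pose psi s := k * s * Jp (k * s).
have [cu cz] := polar_cont h.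
pose W s := z s * phi s - u s * psi s.
(* Here z = s u' and psi = s phi'. The bound on [a] makes this derivative positive, whereas W(0) = 0
   and W(r1) = r1 u'(r1) phi(r1) <= 0. *)
have hW (s : R) : 0 < s < r1 -> is_derive s 1 W (u s * phi s * (m%:R ^+ 2 / s - a * s + k ^+ 2 * s)).
  move=> /andP[s0 _]; have [h1 h2] := polar_der h s0.
  have := derD (derM h2 (hphi s)) (derN (derM h1 (hpsi s s0))).
  congr is_derive; rewrite /u /phi [s ^+ m.+1]exprS; field; rewrite gt_eqF //.
have ckt : continuous (fun s : R => k * s) by move=> s; exact: der_cont (hk s).
have : W 0 < W r1.
  apply: (der_gt0_lt r10 hW).
    apply: cont_within => s _; apply: cvgB; apply: cvgM.
    - exact: cz.
    - exact: der_cont (hphi s).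
    - exact: cu.
    - apply: cvgM; first exact: ckt.
      exact: (cvg_comp _ _ (ckt s) (cJp _)).
  move=> s /andP[s0 s1].
  have sR : s < Rad := lt_le_trans s1 r1r.
  rewrite mulr_gt0 //; first by rewrite mulr_gt0 ?mulr_gt0 ?exprn_gt0 ?wpos ?phipos ?s1 ?sR // ltW.
  rewrite (_ : _ + _ = s * (m%:R ^+ 2 / s ^+ 2 - a + k ^+ 2)); last by field; rewrite gt_eqF.
  rewrite mulr_gt0 //.
  have : m%:R ^+ 2 / Rad ^+ 2 <= m%:R ^+ 2 / s ^+ 2.
    rewrite ler_wpM2l ?sqr_ge0 // lef_pV2 ?posrE ?exprn_gt0 //.
    by rewrite lerXn2r ?nnegrE ?ltW.
  move: ha; rewrite mulrDl /k exprMn exprVn; lra.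
rewrite /W /z /u !expr0n gtn_eqF //= wr1 !(mul0r, mulr0) !add0r !subr0 ltNge => /negP; apply.
by rewrite mul0r mulr_le0_ge0 // mulr_ge0_le0 ?exprn_ge0 ?(ltW r10).
Qed.

(* Picone's identity: with X = r u' / u for u = r^m w, (phi^2 X)' is at most
   r phi'^2 + (m^2 / r - a r) phi^2; here phi is the tent min (r, Rad - r). *)
Lemma linear_has_zero m (Rad a : R) w y : (0 < m)%N -> 0 < Rad ->
  12 * (1 + m%:R ^+ 2 * (2 * ln 2 - 1)) / Rad ^+ 2 < a ->
  radial m.*2.+1 (fun s => a * w s) w y -> w 0 = 1 ->
  exists2 r, 0 <= r <= Rad & w r <= 0.
Proof.
move=> m0 Rad0 ha h w0; apply: contrapT => hn.
have wpos r : 0 <= r <= Rad -> 0 < w r.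
  by move=> rR; rewrite ltNge; apply/negP => wr; apply: hn; exists r.
have [hw cy _] := h.
pose X r := m%:R + r * (y r / w r).
(* The Riccati equation of the logarithmic derivative X = m + r w'/w; positivity of [w] keeps [X]
   finite up to [Rad]. *)
have hX (r : R) : 0 < r < Rad -> is_derive r 1 X (m%:R ^+ 2 / r - a * r - X r ^+ 2 / r).
  move=> /andP[rp rR]; have wr : w r != 0 by rewrite gt_eqF // wpos // !ltW.
  have := derD (der_cst r m%:R) (derM (der_id r) (derM (radial_dy h rp) (derV wr (hw r)))).
  congr is_derive; rewrite /X -natr1 -mul2n natrM; field.
  by rewrite gt_eqF.
have cX r : 0 <= r <= Rad -> {for r, continuous X}.
  move=> rR; apply: cvgD; first exact: cvg_cst.
  apply: cvgM; first exact: cvg_id.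
  apply: cvgM; first exact: cy.
  apply: cvgV; first by rewrite gt_eqF // wpos.
  exact: radial_cont h r.
pose c := Rad / 2.
have c0 : 0 < c by rewrite divr_gt0.
have cR : c < Rad by rewrite /c; lra.
(* Left half of the tent, phi = r: the defect in Picone's inequality is the square r (1 - X)^2. *)
have s1 : c ^+ 2 * X c <= (1 + m%:R ^+ 2) * c ^+ 2 / 2 - a * c ^+ 4 / 4.
  have := @der_mono R (fun r => r ^+ 2 * X r) (fun r => (1 + m%:R ^+ 2) / 2 * r ^+ 2 - a / 4 * r ^+ 4)
    (fun r => 2%:R * r ^+ 1 * 1 * X r + r ^+ 2 * (m%:R ^+ 2 / r - a * r - X r ^+ 2 / r))
    (fun r => (1 + m%:R ^+ 2) * r - a * r ^+ 3) 0 c (ltW c0).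
  rewrite !expr0n /= !(mul0r, mulr0) !subr0.
  have hg (r : R) : is_derive r 1 (fun r => (1 + m%:R ^+ 2) / 2 * r ^+ 2 - a / 4 * r ^+ 4)
      ((1 + m%:R ^+ 2) * r - a * r ^+ 3).
    have := derD (derM (der_cst r ((1 + m%:R ^+ 2) / 2)) (derX 2 (der_id r)))
      (derN (derM (der_cst r (a / 4)) (derX 4 (der_id r)))).
    by congr is_derive; rewrite /=; field.
  move=> H; apply: le_trans; first apply: H.
  - move=> r /andP[rp rc]; apply: derM; first exact: derX (der_id r).
    by apply: hX; rewrite rp (lt_trans rc).
  - apply: cont_within => r /andP[rp rc]; apply: cvgM; first exact: exprn_continuous.
    by apply: cX; rewrite rp (le_trans rc) // ltW.
  - by apply: cont_within => r _; exact: der_cont (hg r).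
  - move=> r /andP[rp rc]; rewrite -subr_ge0.
    rewrite (_ : _ - _ = r * (1 - X r) ^+ 2); last by field; rewrite gt_eqF.
    by rewrite mulr_ge0 ?sqr_ge0 // ltW.
  - by rewrite le_eqVlt; apply/orP; left; apply/eqP; ring.
(* Right half, phi = Rad - r: [G] is a primitive of r + (Rad - r)^2 (m^2/r - a r). Its logarithm is
   the source of ln 2. *)
pose G r := r ^+ 2 / 2 + m%:R ^+ 2 * (Rad ^+ 2 * ln r - 2 * Rad * r + r ^+ 2 / 2)
  - a * (Rad ^+ 2 * r ^+ 2 / 2 - 2 * Rad * r ^+ 3 / 3 + r ^+ 4 / 4).
have s2 : (Rad - Rad) ^+ 2 * X Rad - (Rad - c) ^+ 2 * X c <= G Rad - G c.
  have hG (r : R) : 0 < r -> is_derive r 1 G (r + (Rad - r) ^+ 2 * (m%:R ^+ 2 / r - a * r)).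
    move=> rp; rewrite /G.
    have hsq := derM (derX 2 (der_id r)) (der_cst r (2^-1 : R)).
    have hln := derM (der_cst r (Rad ^+ 2)) (is_derive1_ln rp).
    have h1 := derD hsq (derM (der_cst r (m%:R ^+ 2))
      (derD (derD hln (derN (derM (der_cst r (2 * Rad)) (der_id r)))) hsq)).
    have h2 := derD (derD (derM (derM (der_cst r (Rad ^+ 2)) (derX 2 (der_id r))) (der_cst r (2^-1 : R)))
      (derN (derM (derM (der_cst r (2 * Rad)) (derX 3 (der_id r))) (der_cst r (3^-1 : R)))))
      (derM (derX 4 (der_id r)) (der_cst r (4^-1 : R))).
    have := derD h1 (derN (derM (der_cst r a) h2)).
    by congr is_derive; rewrite /=; field; rewrite gt_eqF.
  apply: (@der_mono R (fun r => (Rad - r) ^+ 2 * X r) G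
    (fun r => 2%:R * (Rad - r) ^+ 1 * (0 - 1) * X r + (Rad - r) ^+ 2 * (m%:R ^+ 2 / r - a * r - X r ^+ 2 / r))
    (fun r => r + (Rad - r) ^+ 2 * (m%:R ^+ 2 / r - a * r)) c Rad (ltW cR)).
  - move=> r /andP[rp rc]; apply: derM.
      exact: (@derX _ (fun t => Rad - t) r _ 2 (derD (der_cst r Rad) (derN (der_id r)))).
    by apply: hX; rewrite rc (lt_trans c0).
  - by move=> r /andP[rp _]; apply: hG; exact: lt_trans rp.
  - apply: cont_within => r /andP[rp rc]; apply: cvgM.
      exact: der_cont (@derX _ (fun t => Rad - t) r _ 2 (derD (der_cst r Rad) (derN (der_id r)))).
    by apply: cX; rewrite rc (le_trans _ rp) // ltW.
  - by apply: cont_within => r /andP[rp _]; apply: der_cont (hG r _); exact: lt_le_trans rp.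
  - move=> r /andP[rp rc]; have r0 : 0 < r := lt_trans c0 rp; rewrite -subr_ge0.
    rewrite (_ : _ - _ = ((Rad - r) * X r + r) ^+ 2 / r); last by field; rewrite gt_eqF.
    by rewrite divr_ge0 ?sqr_ge0 // ltW.
have lnc : ln c = ln Rad - ln 2 by rewrite /c ln_div ?posrE.
have ha' : 12 * (1 + m%:R ^+ 2 * (2 * ln 2 - 1)) * Rad ^+ 2 < a * Rad ^+ 4.
  move: ha; rewrite ltr_pdivrMr ?exprn_gt0 // => ha.
  have R2 : 0 < Rad ^+ 2 by rewrite exprn_gt0.
  by rewrite -(ltr_pM2r R2) in ha; move: ha; rewrite -[a * _ * _]mulrA -exprD.
have tot : 0 <= (1 + m%:R ^+ 2) * c ^+ 2 / 2 - a * c ^+ 4 / 4 + (G Rad - G c).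
  move: s2; rewrite subrr expr0n /= mul0r sub0r (_ : Rad - c = c); last by rewrite /c; field.
  lra.
move: tot; rewrite /G lnc /c.
(* The boundary terms at c = Rad/2 cancel and those at the ends vanish; what remains is negative by
   the choice of [a]. *)
rewrite [X in 0 <= X](_ : _ = (12 * (1 + m%:R ^+ 2 * (2 * ln 2 - 1)) * Rad ^+ 2 - a * Rad ^+ 4) / 24); last by field.
by rewrite leNgt => /negP; apply; rewrite pmulr_llt0 ?invr_gt0 // subr_lt0.
Qed.
End Comparison.

(** * The reaction term and large amplitudes *)

Section Shooting.
Local Open Scope classical_set_scope.
Local Open Scope ring_scope.
Context {R : realType}.
Implicit Types (f q w y : R -> R) (p m : nat) (r b s x : R).

Lemma sat_den_gt0 b x : 0 <= b -> 0 < 1 + b * x ^+ 2.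
Proof. by move=> b0; rewrite ltr_pwDl // mulr_ge0 // sqr_ge0. Qed.

(** The difference quotient is (1 - b x x') / ((1 + b x^2)(1 + b x'^2)), and 2 |x x'| <= x^2 + x'^2
    bounds it by 1 uniformly in [b]. *)
Lemma sat_lip b x x' : 0 <= b ->
  `|x / (1 + b * x ^+ 2) - x' / (1 + b * x' ^+ 2)| <= `|x - x'|.
Proof.
move=> b0; have h := sat_den_gt0 x b0; have h' := sat_den_gt0 x' b0.
have -> : x / (1 + b * x ^+ 2) - x' / (1 + b * x' ^+ 2) =
    (x - x') * ((1 - b * (x * x')) / ((1 + b * x ^+ 2) * (1 + b * x' ^+ 2))).
  by field; rewrite !gt_eqF.
rewrite normrM ler_piMr // normrM normfV (gtr0_norm (mulr_gt0 h h')).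
rewrite ler_pdivrMr ?mulr_gt0 // mul1r.
have bx : 0 <= b * x ^+ 2 by rewrite mulr_ge0 ?sqr_ge0.
have bx' : 0 <= b * x' ^+ 2 by rewrite mulr_ge0 ?sqr_ge0.
have h1 : 0 <= b * (x - x') ^+ 2 by rewrite mulr_ge0 ?sqr_ge0.
have h2 : 0 <= b * (x + x') ^+ 2 by rewrite mulr_ge0 ?sqr_ge0.
have h3 : 0 <= b * x ^+ 2 * (b * x' ^+ 2) by rewrite mulr_ge0.
rewrite ler_norml; apply/andP; split; nra.
Qed.

Lemma sat_dep b b' x : 0 <= b -> 0 <= b' ->
  `|x / (1 + b * x ^+ 2) - x / (1 + b' * x ^+ 2)| <= `|x| * x ^+ 2 * `|b - b'|.
Proof.
move=> b0 b0'; have h := sat_den_gt0 x b0; have h' := sat_den_gt0 x b0'.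
have -> : x / (1 + b * x ^+ 2) - x / (1 + b' * x ^+ 2) =
    x * x ^+ 2 * (b' - b) / ((1 + b * x ^+ 2) * (1 + b' * x ^+ 2)).
  by field; rewrite !gt_eqF.
rewrite normrM normfV (gtr0_norm (mulr_gt0 h h')) ler_pdivrMr ?mulr_gt0 //.
rewrite 2!normrM (ger0_norm (sqr_ge0 x)) (distrC b') ler_peMr ?(mulr_ge0 (mulr_ge0 (normr_ge0 x) (sqr_ge0 x))) //.
have bx : 0 <= b * x ^+ 2 by rewrite mulr_ge0 ?sqr_ge0.
have bx' : 0 <= b' * x ^+ 2 by rewrite mulr_ge0 ?sqr_ge0.
by have := mulr_ge0 bx bx'; move: bx bx'; set P := b * _; set P' := b' * _; lra.
Qed.

(** Comes from 2u^2/(1 + alpha u^2) = (2/alpha)(1 - 1/(1 + alpha u^2)) with u = a s^m x and b =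
    alpha a^2; then tau = 2/alpha and mu = 2/alpha - 2 kappa. The linear coefficient is mu - tau at
    b = 0 and tends to mu as b grows. *)
Definition reaction (mu tau b : R) m s x : R :=
  mu * x - tau * (x / (1 + b * (s ^+ m) ^+ 2 * x ^+ 2)).

Lemma reaction_lip mu tau b m s x x' : 0 <= b -> 0 <= tau ->
  `|reaction mu tau b m s x - reaction mu tau b m s x'| <= (`|mu| + tau) * `|x - x'|.
Proof.
move=> b0 t0; rewrite /reaction.
have B0 : 0 <= b * (s ^+ m) ^+ 2 by rewrite mulr_ge0 ?sqr_ge0.
have h := sat_lip x x' B0; set P := x / _ in h *; set P' := x' / _ in h *.
rewrite (_ : _ - _ - _ = mu * (x - x') - tau * (P - P')); last by ring.
rewrite (le_trans (ler_normB _ _)) // !normrM (ger0_norm t0) mulrDl lerD2l.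
by rewrite ler_wpM2l.
Qed.

Lemma reaction_norm mu tau b m s x : 0 <= b -> 0 <= tau ->
  `|reaction mu tau b m s x| <= (`|mu| + tau) * `|x|.
Proof.
move=> b0 t0; have := reaction_lip mu m s x 0 b0 t0.
by rewrite subr0 {2}/reaction !(mulr0, mul0r) !subr0.
Qed.

Lemma reaction_cont mu tau b m w : 0 <= b -> continuous w ->
  continuous (fun s => reaction mu tau b m s (w s)).
Proof.
move=> b0 cw s; have B0 : 0 <= b * (s ^+ m) ^+ 2 by rewrite mulr_ge0 ?sqr_ge0.
apply: cvgB; apply: cvgM; [exact: cvg_cst|exact: cw|exact: cvg_cst|].
apply: cvgM; first exact: cw.
apply: cvgV; first by rewrite gt_eqF // sat_den_gt0.
have ce t : continuous (fun s : R => s ^+ t) by exact: exprn_continuous.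
apply: cvgD; first exact: cvg_cst.
apply: cvgM; last exact: (cvg_comp _ _ (cw s) (ce 2%N _)).
apply: cvgM; first exact: cvg_cst.
exact: (cvg_comp _ _ (ce m s) (ce 2%N _)).
Qed.

(** Comparison with the constant 1: from |q| <= L |w - 1| + L one gets |w - 1| <= e^(lr) - 1, at
    most 1/2 up to r = ln(3/2)/l. The radius depends on [L] alone, hence not on [b]. *)
Lemma uniform_half (L : R) : 0 < L -> exists2 rho, 0 < rho &
  forall p q w y, (0 < p)%N -> radial p q w y -> w 0 = 1 ->
    (forall r, 0 < r -> `|q r| <= L * `|w r|) ->
    forall r, 0 <= r <= rho -> 2^-1 <= w r.
Proof.
move=> L0; set l := Num.sqrt (2 * L).
have l0 : 0 < l by rewrite sqrtr_gt0 mulr_gt0.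
have h32 : (1 : R) < 3 / 2 by lra.
exists (ln (3 / 2) / l); first by rewrite divr_gt0 // ln_gt0.
move=> p q w y p0 h w0 hq r rr.
have := @radial_stable R p _ _ _ _ _ _ L L (ln (3 / 2) / l) p0 h (radial_cst p 1) w0 L0 (ltW L0) _ r rr.
rewrite -/l divff ?gt_eqF // mul1r => H.
have : `|w r - 1| <= expR (l * r) - 1.
  apply: H => s /andP[s0 _]; rewrite subr0 (le_trans (hq s s0)) //.
  rewrite -[X in _ + X]mulr1 -mulrDr ler_wpM2l ?(ltW L0) //.
  by have := ler_normD (w s - 1) 1; rewrite subrK normr1.
have : expR (l * r) <= 3 / 2.
  rewrite -[X in _ <= X]lnK ?posrE; last by lra.
  case/andP: rr => _ rr; rewrite ler_expR mulrC -ler_pdivlMr //.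
by rewrite ler_norml => ? /andP[? ?]; lra.
Qed.

(* Wronskian of u = r^m w with psi = r^m v: the saturated term costs at most
   tau r psi / (2 sqrt b), because u / (1 + b u^2) <= 1 / (2 sqrt b). *)
Lemma large_b_has_zero m (mu mu' tau Rad : R) v yv : (0 < m)%N -> 0 < tau -> mu' < mu ->
  radial m.*2.+1 (fun s => mu' * v s) v yv -> v 0 = 1 ->
  (exists2 r, 0 <= r <= Rad & v r <= 0) ->
  exists2 B, 0 <= B & forall b w y, B <= b ->
    radial m.*2.+1 (fun s => reaction mu tau b m s (w s)) w y -> w 0 = 1 ->
    exists2 r, 0 <= r <= Rad & w r <= 0.
Proof.
move=> m0 tau0 mumu hv v0 vz; have cv := radial_cont hv.
have [|r1 [r10 r1R vr1 vpos]] := first_zero cv _ vz; first by rewrite v0.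
have [dv cyv _] := hv.
have yv1 : yv r1 <= 0 by apply: (slope_first_zero r10 dv cyv vr1) => s sr; exact/ltW/vpos.
(* This constant dominates both reactions, so one radius [rho] serves [v] and every [w]. *)
have L0 : 0 < `|mu| + `|mu'| + tau by rewrite ltr_wpDl // addr_ge0.
have [rho rho0 hrho] := uniform_half L0.
have tpos : 0 < Num.min rho r1 by rewrite lt_min rho0.
set t := Num.min rho r1 in tpos.
have trho : t <= rho by rewrite ge_min lexx.
have tr1 : t <= r1 by rewrite ge_min lexx orbT.
pose psi s := s ^+ m * v s; pose zeta s := m%:R * s ^+ m * v s + s ^+ m.+1 * yv s.
have [cpsi czeta] := polar_cont hv.
have [D D0 hD] : exists2 D, 0 < D & forall s, 0 <= s <= r1 -> s * psi s <= D.
  have cf : {within `[0, r1], continuous (fun s => s * psi s)}.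
    by apply: cont_within => s _; apply: cvgM; [exact: cvg_id|exact: cpsi].
  have [c _ hc] := EVT_max (ltW r10) cf.
  exists (`|c * psi c| + 1); first by rewrite ltr_wpDl.
  move=> s sr; have := hc s; rewrite in_itv /= => /(_ sr) h.
  by rewrite (le_trans h) // (le_trans (ler_norm _)) // lerDl.
have dm0 : 0 < mu - mu' by rewrite subr_gt0.
(* The guaranteed gain of the Wronskian on [0, t], where v and w are at least 1/2: the integral of
   (mu - mu') s^(2m+1) / 4. *)
pose c := (mu - mu') / 4 * (t ^+ m.*2.+2 / m.*2.+2%:R).
have c0 : 0 < c by rewrite mulr_gt0 ?divr_gt0 ?exprn_gt0 ?ltr0n.
(* For sqrt b >= g0 the total loss tau D r1 / (2 sqrt b) on [0, r1] stays below the gain [c]. *)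
pose g0 := tau * D * r1 / c + 1.
have g00 : 0 < g0 by rewrite ltr_wpDl // divr_ge0 ?ltW // !mulr_gt0.
exists (g0 ^+ 2); first exact: sqr_ge0.
move=> b w y bB h w0; apply: contrapT => hn.
have wpos r : 0 <= r <= Rad -> 0 < w r.
  by move=> rR; rewrite ltNge; apply/negP => wr; apply: hn; exists r.
have b0 : 0 <= b := le_trans (sqr_ge0 _) bB.
pose g := Num.sqrt b.
have gb : g ^+ 2 = b by rewrite sqr_sqrtr.
have gg0 : g0 <= g by rewrite -(ler_pXn2r (n := 2)) ?nnegrE ?sqrtr_ge0 ?(ltW g00) // gb.
have g_gt0 : 0 < g := lt_le_trans g00 gg0.
have [cu cz] := polar_cont h.
pose u s := s ^+ m * w s; pose z s := m%:R * s ^+ m * w s + s ^+ m.+1 * y s.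
pose W s := u s * zeta s - z s * psi s.
pose dW s := s * psi s * ((mu - mu') * u s - tau * (u s / (1 + b * u s ^+ 2))).
have hW (s : R) : 0 < s -> is_derive s 1 W (dW s).
  move=> s0; have [h1 h2] := polar_der h s0; have [h3 h4] := polar_der hv s0.
  have := derD (derM h1 h4) (derN (derM h2 h3)).
  have d0 := sat_den_gt0 (s ^+ m * w s) b0.
  congr is_derive; rewrite /dW /u /psi /reaction [s ^+ m.+1]exprS; field.
  by rewrite (gt_eqF s0) (gt_eqF d0).
have cW a a' : {within `[a, a'], continuous W}.
  by apply: cont_within => s _; apply: cvgB; apply: cvgM; [exact: cu|exact: czeta|exact: cz|exact: cpsi].
pose K := tau * D / (2 * g).
have dWge s : 0 < s < r1 -> (mu - mu') * (s * psi s * u s) - K <= dW s.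
  move=> /andP[s0 s1].
  have hu : 0 < u s by rewrite mulr_gt0 ?exprn_gt0 // wpos // (ltW s0) (le_trans (ltW s1)).
  have hps : 0 < s * psi s by rewrite !mulr_gt0 ?exprn_gt0 // vpos // s1 ltW.
  have sat : u s / (1 + b * u s ^+ 2) <= (2 * g)^-1.
    rewrite ler_pdivrMr ?sat_den_gt0 // mulrC ler_pdivlMr ?mulr_gt0 // -gb.
    have := sqr_ge0 (g * u s - 1); nra.
  have h1 : s * psi s * (tau * (u s / (1 + b * u s ^+ 2))) <= D * (tau / (2 * g)).
    apply: ler_pM; [exact: ltW| |by apply: hD; rewrite !ltW|by rewrite ler_pM2l].
    by rewrite mulr_ge0 ?(ltW tau0) // divr_ge0 ?(ltW hu) // ltW // sat_den_gt0.
  rewrite /dW /K mulrBr (_ : tau * D / _ = D * (tau / (2 * g))); last by ring.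
  by rewrite [s * psi s * ((mu - mu') * _)]mulrCA lerB.
have W0 : W 0 = 0.
  by rewrite /W /u /z /zeta /psi !expr0n gtn_eqF //= !(mul0r, mulr0) ?(addr0, add0r, subr0, mul0r, subrr) ?oppr0.
have qv r : `|mu' * v r| <= (`|mu| + `|mu'| + tau) * `|v r|.
  rewrite normrM ler_wpM2r //; have := normr_ge0 mu; have := ltW tau0; lra.
have qw r : `|reaction mu tau b m r (w r)| <= (`|mu| + `|mu'| + tau) * `|w r|.
  rewrite (le_trans (reaction_norm _ _ _ _ b0 (ltW tau0))) // ler_wpM2r //.
  have := normr_ge0 mu'; lra.
have Wt : c - K * t <= W t.
  have hG (s : R) : is_derive s 1 (fun s => (mu - mu') / 4 / m.*2.+2%:R * s ^+ m.*2.+2 - K * s)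
      ((mu - mu') / 4 * s ^+ m.*2.+1 - K).
    have := derD (derM (der_cst s ((mu - mu') / 4 / m.*2.+2%:R)) (derX m.*2.+2 (der_id s)))
      (derN (derM (der_cst s K) (der_id s))).
    congr is_derive; rewrite /=; field.
    by rewrite ?pnatr_eq0 -?natrD ?pnatr_eq0.
  have := @der_mono R _ W _ dW 0 t (ltW tpos) (fun s _ => hG s).
  rewrite W0 subr0 expr0n /= !mulr0 !subr0 => H.
  have -> : c - K * t = (mu - mu') / 4 / m.*2.+2%:R * t ^+ m.*2.+2 - K * t by rewrite /c; ring.
  apply: H => //.
  - by move=> s /andP[s0 _]; exact: hW.
  - by apply: cont_within => s _; exact: der_cont (hG s).
  - move=> s /andP[s0 st].
    have sr1 : 0 < s < r1 by rewrite s0 (lt_le_trans st).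
    have srho : 0 <= s <= rho by rewrite ltW //= (le_trans (ltW st)).
    apply: le_trans (dWge s sr1); rewrite lerD2r -mulrA ler_pM2l //.
    have hv2 : 2^-1 <= v s by apply: (hrho _ _ _ _ _ hv v0) => // r _; exact: qv.
    have hw2 : 2^-1 <= w s by apply: (hrho _ _ _ _ _ h w0) => // r _; exact: qw.
    have -> : s * psi s * u s = s ^+ m.*2.+1 * (v s * w s).
      by rewrite /psi /u exprS -addnn exprD; ring.
    rewrite mulrC ler_pM2l ?exprn_gt0 //; nra.
have Wr1 : - K * (r1 - t) <= W r1 - W t.
  have hG (s : R) : is_derive s 1 (fun s => - K * s) (- K).
    by have := derM (der_cst s (- K)) (der_id s); rewrite mul0r add0r mulr1.
  have := @der_mono R _ W _ dW t r1 tr1 (fun s _ => hG s).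
  rewrite mulrBr; apply => //.
  - by move=> s /andP[s0 _]; apply: hW; exact: lt_trans s0.
  - by apply: cont_within => s _; exact: der_cont (hG s).
  - move=> s /andP[s0 s1]; have sp := lt_trans tpos s0.
    apply: le_trans (dWge s _); last by rewrite sp.
    rewrite lerDr mulr_ge0 ?(ltW dm0) // !mulr_ge0 ?exprn_ge0 ?(ltW sp) //.
      by rewrite ltW // vpos // s1 ltW.
    by rewrite ltW // wpos // ltW //= (le_trans (ltW s1)).
(* At [r1] only u zeta survives, and zeta has the sign of v'(r1) <= 0; this contradicts W(r1) >= c -
   K r1 > 0. *)
have W1 : W r1 <= 0.
  rewrite /W /psi /zeta vr1 !mulr0 add0r subr0 /u.
  rewrite mulr_ge0_le0 ?mulr_ge0_le0 ?exprn_ge0 ?(ltW r10) // mulr_ge0 ?exprn_ge0 ?(ltW r10) //.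
  by rewrite ltW // wpos // ltW.
have Kc : K * r1 < c.
  have : tau * D * r1 < c * (2 * g).
    rewrite [X in _ < X]mulrC -ltr_pdivrMr //; apply: (@lt_le_trans _ _ g0); last by lra.
    by rewrite /g0 ltrDl.
  rewrite (_ : K * r1 = tau * D * r1 / (2 * g)); last by rewrite /K; ring.
  by rewrite ltr_pdivrMr ?mulr_gt0.
by move: Wt Wr1; nra.
Qed.
End Shooting.

(** * Shooting *)

Section Final.
Local Open Scope classical_set_scope.
Local Open Scope ring_scope.
Context {R : realType}.
Implicit Types (f q w y : R -> R) (p m : nat) (r b s x : R).

(** The change of the reaction splits into a Lipschitz part in [w] and the effect of [b] at the
    fixed profile [w0], at most tau D |b - b0| with D bounding r^(2m) |w0|^3; [radial_stable]
    concludes. The constant does not depend on [b] or [w]. *)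
Lemma reaction_stable m (mu tau Rad b0 : R) w0 y0 : 0 < tau -> 0 <= b0 ->
  radial m.*2.+1 (fun s => reaction mu tau b0 m s (w0 s)) w0 y0 -> w0 0 = 1 ->
  exists2 C, 0 < C & forall b w y, 0 <= b ->
    radial m.*2.+1 (fun s => reaction mu tau b m s (w s)) w y -> w 0 = 1 ->
    forall r, 0 <= r <= Rad -> `|w r - w0 r| <= C * `|b - b0|.
Proof.
move=> tau0 b00 h0 w00; have [Rad0|Rad0] := ltP Rad 0.
  by exists 1 => // b w y _ _ _ r /andP[r0 rR]; move: (le_trans r0 rR); rewrite leNgt Rad0.
set L := `|mu| + tau; have L0 : 0 < L by rewrite ltr_wpDl.
pose l := Num.sqrt (2 * L).
have [D D0 hD] : exists2 D, 0 < D & forall s, 0 <= s <= Rad ->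
    `|w0 s| * (s ^+ m) ^+ 2 * w0 s ^+ 2 <= D.
  have cw := radial_cont h0.
  have cf : {within `[0, Rad], continuous (fun s => `|w0 s| * (s ^+ m) ^+ 2 * w0 s ^+ 2)}.
    apply: cont_within => s _.
    have ce t : continuous (fun s : R => s ^+ t) by exact: exprn_continuous.
    apply: cvgM; last exact: (cvg_comp _ _ (cw s) (ce 2%N _)).
    apply: cvgM; last exact: (cvg_comp _ _ (ce m s) (ce 2%N _)).
    by apply: cvg_norm; exact: cw.
  have [c _ hc] := EVT_max Rad0 cf.
  exists (`|w0 c| * (c ^+ m) ^+ 2 * w0 c ^+ 2 + 1); first by rewrite ltr_wpDl // mulr_ge0 ?sqr_ge0 // mulr_ge0 ?sqr_ge0.
  move=> s sr; have := hc s; rewrite in_itv /= => /(_ sr) h.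
  by rewrite (le_trans h) // lerDl.
exists (tau * D / L * expR (l * Rad)); first by rewrite !mulr_gt0 ?invr_gt0 ?expR_gt0.
move=> b w y bge h w1 r rR; have /andP[r0 rle] := rR.
have e0 : 0 <= tau * D * `|b - b0| by rewrite !mulr_ge0 // ltW.
have := @radial_stable R _ _ _ _ _ _ _ L _ Rad _ h h0 _ L0 e0 _ r rR.
rewrite w1 w00 => /(_ isT erefl) H; apply: (le_trans (H _)).
  move=> s /andP[s0 sR].
  have sR' : 0 <= s <= Rad by rewrite !ltW.
  have h1 := reaction_lip mu m s (w s) (w0 s) bge (ltW tau0).
  have h2 : `|reaction mu tau b m s (w0 s) - reaction mu tau b0 m s (w0 s)| <= tau * D * `|b - b0|.
    rewrite /reaction.
    have Bb x : 0 <= x -> 0 <= x * (s ^+ m) ^+ 2 by move=> ?; rewrite mulr_ge0 ?sqr_ge0.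
    have := sat_dep (w0 s) (Bb _ bge) (Bb _ b00).
    set P := w0 s / _; set P' := w0 s / _ => hP.
    rewrite (_ : _ - _ - _ = - (tau * (P - P'))); last by ring.
    rewrite normrN normrM (gtr0_norm tau0) -mulrA ler_pM2l // (le_trans hP) //.
    rewrite -mulrBl normrM (ger0_norm (sqr_ge0 _)) [`|b - b0| * _]mulrC mulrA ler_wpM2r //.
    by rewrite mulrAC hD.
  rewrite -/L in h1.
  have := ler_normD (reaction mu tau b m s (w s) - reaction mu tau b m s (w0 s))
    (reaction mu tau b m s (w0 s) - reaction mu tau b0 m s (w0 s)).
  rewrite subrKA; lra.
rewrite -/l (_ : tau * D / L * expR (l * Rad) * _ = tau * D * `|b - b0| / L * expR (l * Rad)); last by ring.
rewrite ler_wpM2l ?divr_ge0 ?(ltW L0) // (le_trans (y := expR (l * r))) ?gerBl //.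
by rewrite ler_expR ler_wpM2l // sqrtr_ge0.
Qed.

(* Shooting in b = alpha a^2, where a is the leading coefficient of u = a r^m w:
   b is the supremum of the parameters for which w stays positive on [0, Rad]. *)
Lemma shooting m (r0 mu tau Rad : R) : (0 < m)%N -> first_pos_zero_J0 r0 -> 0 < Rad ->
  0 < tau -> mu - tau < (m%:R ^+ 2 + r0 ^+ 2) / Rad ^+ 2 ->
  12 * (1 + m%:R ^+ 2 * (2 * ln 2 - 1)) / Rad ^+ 2 < mu ->
  exists b w y, [/\ 0 < b,
    radial m.*2.+1 (fun s => reaction mu tau b m s (w s)) w y,
    forall r, 0 <= r < Rad -> 0 < w r & w Rad = 0].
Proof.
move=> m0 hr0 Rad0 tau0 hlow hhigh.
set L := `|mu| + tau; have L0 : 0 < L by rewrite ltr_wpDl.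
(* [S b] is the shooting solution with its derivative; for negative [b] it is a dummy. *)
have /choice [S hS] : forall b, exists wy : (R -> R) * (R -> R), 0 <= b ->
    radial m.*2.+1 (fun s => reaction mu tau b m s (wy.1 s)) wy.1 wy.2 /\ wy.1 0 = 1.
  move=> b; have [b0|nb] := pselect (0 <= b); last by exists (cst 0, cst 0).
  have [|||w [y [h [w0 _]]]] := @radial_solution R m.*2.+1 (reaction mu tau b m) L isT L0.
  - by move=> w cw; exact: reaction_cont.
  - by move=> s x x'; apply: reaction_lip => //; exact: ltW.
  - by move=> s; rewrite /reaction !(mulr0, mul0r) subr0.
  - by exists (w, y).
pose pos b := forall r, 0 <= r <= Rad -> 0 < (S b).1 r.
pose A := [set b : R | 0 <= b /\ pos b].
have A0 : A 0.
  split=> //; have [h w0] := hS 0 (lexx _).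
  apply: (linear_positive m0 hr0 Rad0 hlow _ w0 (y := (S 0).2)).
  by apply: radial_ext h => r _; rewrite /reaction !mul0r addr0 divr1 mulrBl.
have [B B0 hB] : exists2 B, 0 <= B & forall b, B <= b -> ~ pos b.
  set T := 12 * _ / _ in hhigh.
  (* Strictly between the threshold and [mu]: the linear solution for mu' still has a zero, and mu -
     mu' > 0 is left to beat the saturated term. *)
  pose mu' := (mu + T) / 2.
  have h1 : mu' < mu by rewrite /mu'; lra.
  have h2 : T < mu' by rewrite /mu'; lra.
  have L0' : 0 < `|mu'| + 1 by rewrite ltr_wpDl.
  have [|||v [yv [hv [v0 _]]]] := @radial_solution R m.*2.+1 (fun _ x => mu' * x) _ isT L0'.
  - by move=> w cw s; apply: cvgM; [exact: cvg_cst|exact: cw].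
  - by move=> s x x'; rewrite -mulrBr normrM ler_wpM2r // lerDl.
  - by move=> s; rewrite mulr0.
  have vz := linear_has_zero m0 Rad0 h2 hv v0.
  have [B B0 hB] := large_b_has_zero m0 tau0 h1 hv v0 vz.
  exists B => // b Bb pb; have [h w0] := hS b (le_trans B0 Bb).
  by have [r rR wr] := hB _ _ _ Bb h w0; have := pb r rR; rewrite ltNge wr.
have hsA : has_sup A.
  split; first by exists 0.
  by exists B => b [_ pb]; rewrite leNgt; apply/negP => /ltW /hB.
pose b := sup A.
have b0 : 0 <= b by apply: ub_le_sup hsA.2 _ _.
have [h w0] := hS b b0; set w := (S b).1 in h w0; set y := (S b).2 in h.
have [C C0 hC] := reaction_stable Rad tau0 b0 h w0.
(* A negative value at the supremum would persist for parameters of [A] close enough below it. *)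
have wge r : 0 <= r <= Rad -> 0 <= w r.
  move=> rR; rewrite leNgt; apply/negP => wr.
  have e0 : 0 < - w r / C by rewrite divr_gt0 // oppr_gt0.
  have [b' [b'0 pb'] lt'] := sup_adherent e0 hsA.
  have [h' w'0] := hS b' b'0; have := hC _ _ _ b'0 h' w'0 r rR.
  have le' : b' <= b by apply: ub_le_sup hsA.2 _ _.
  rewrite (distrC b') (@ger0_norm _ (b - b')) ?subr_ge0 //.
  have : C * (b - b') < - w r by rewrite mulrC -ltr_pdivlMr //; move: lt'; rewrite -/b; lra.
  have := pb' r rR; have := ler_norm ((S b').1 r - w r); lra.
have npb : ~ pos b.
  move=> pb.
  have cw : {within `[0, Rad], continuous w}.
    by apply: cont_within => s _; exact: radial_cont h s.
  have [c] := EVT_min (ltW Rad0) cw; rewrite in_itv /= => cR hc.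
  have wc : 0 < w c := pb c cR.
  (* If the minimum [w c] were positive, this larger parameter would change the solution by at most
     half of it and so belong to [A]. *)
  pose b' := b + w c / (2 * C).
  have bb' : b < b' by rewrite ltrDl divr_gt0 // mulr_gt0.
  have b'0 : 0 <= b' := le_trans b0 (ltW bb').
  have [h' w'0] := hS b' b'0.
  have : A b'.
    split=> // r rR; have := hC _ _ _ b'0 h' w'0 r rR.
    rewrite [b' - b](_ : _ = w c / (2 * C)); last by rewrite /b'; ring.
    rewrite (@ger0_norm _ (w c / (2 * C))) ?divr_ge0 ?(ltW wc) ?mulr_ge0 ?(ltW C0) //.
    rewrite (_ : C * _ = w c / 2); last by field; rewrite gt_eqF.
    have := hc r; rewrite in_itv /= => /(_ rR).
    by rewrite ler_norml => ? /andP[? _]; lra.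
  by move=> /(ub_le_sup hsA.2); rewrite leNgt bb'.
have bpos : 0 < b.
  rewrite lt_def b0 andbT; apply/eqP => be; apply: npb; rewrite be; exact: A0.2.
have [r rR wr] : exists2 r, 0 <= r <= Rad & w r <= 0.
  apply: contrapT => hn; apply: npb => r rR; rewrite ltNge; apply/negP => wr.
  by apply: hn; exists r.
have [||r1 [r10 r1R wr1 wpos]] := @first_zero R w Rad (radial_cont h).
- by rewrite w0.
- by exists r.
have hq s : 0 < s -> `|reaction mu tau b m s (w s)| <= L * `|w s|.
  by move=> _; apply: reaction_norm => //; exact: ltW.
have ndz := no_double_zero h w0 (ltW L0) hq r10 wr1.
have [dw cy _] := h.
(* An interior zero would be a minimum of the nonnegative [w], so w' would vanish there too: a
   double zero. *)
have r1E : r1 = Rad.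
  apply/eqP/negPn/negP => ne; have r1lt : r1 < Rad by rewrite lt_def eq_sym ne r1R.
  apply: ndz.
  have [||//|_ <-] := @derive1_at_min R w 0 Rad r1 (ltW Rad0) _ _ _.
  - by move=> t _; case: (dw t).
  - by rewrite in_itv /= r10.
  - by move=> t; rewrite in_itv /= => /andP[t0 tR]; rewrite wr1 wge // !ltW.
  - by case: (dw r1).
exists b, w, y; split=> //; last by rewrite -r1E.
by rewrite -r1E.
Qed.
End Final.

(** * From the shooting profile back to the vortex equation *)

Unset Implicit Arguments.
Set Strict Implicit.

Theorem theorem4p7 (R : realType) (r0 : R) (n : int) (alpha Rad kappa : R) :
  first_pos_zero_J0 r0 ->
  (1 <= `|n|)%R -> 0 < alpha -> 0 < Rad ->
  - (((n%:~R) ^+ 2 + r0 ^+ 2) / (2 * Rad ^+ 2)) < kappa ->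
  kappa < alpha^-1 - ((n%:~R) ^+ 2 + r0 ^+ 2) / (2 * Rad ^+ 2) ->
  Num.sqrt (6 * (1 + (n%:~R) ^+ 2 * (2 * ln 2 - 1)) / (alpha^-1 - kappa)) < Rad ->
  exists u : R -> R,
    in_H Rad u /\ (forall r : R, 0 < r < Rad -> 0 < u r) /\
    vortex_solution n alpha kappa Rad u.
Proof.
move=> hr0 n1 alpha0 Rad0 klow khigh hRad.
pose m := `|n|%N.
have nm : (n%:~R : R) ^+ 2 = m%:R ^+ 2.
  by rewrite /m natr_absz intr_norm real_normK ?num_real.
have m0 : (0 < m)%N by move: n1; rewrite /m; case: n {klow khigh hRad nm m} => [[|k]|k].
rewrite nm in klow khigh hRad.
have R2 : 0 < Rad ^+ 2 by rewrite exprn_gt0.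
have T0 : 0 <= (m%:R ^+ 2 + r0 ^+ 2) / Rad ^+ 2 by rewrite divr_ge0 ?addr_ge0 ?sqr_ge0.
rewrite (_ : _ / _ = (m%:R ^+ 2 + r0 ^+ 2) / Rad ^+ 2 / 2) in klow; last by field; rewrite gt_eqF.
rewrite (_ : (_ + _) / _ = (m%:R ^+ 2 + r0 ^+ 2) / Rad ^+ 2 / 2) in khigh; last by field; rewrite gt_eqF.
have ak : 0 < alpha^-1 - kappa by lra.
have tau0 : 0 < 2 / alpha by rewrite divr_gt0.
have [|| b [w [y [b0 h wpos wR]]]] := @shooting R m r0 (2 / alpha - 2 * kappa) (2 / alpha) Rad m0 hr0 Rad0 tau0.
- lra.
- rewrite ltr_pdivrMr //.
  set E := 1 + _ in hRad *.
  have : 6 * E / (alpha^-1 - kappa) < Rad ^+ 2.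
    (* The square root of a negative number is 0 by convention, so squaring the hypothesis needs
       this case split. *)
    have [neg|nn] := ltP (6 * E / (alpha^-1 - kappa)) 0; first exact: lt_trans R2.
    by rewrite -[X in X < _](sqr_sqrtr nn) ltrXn2r ?nnegrE ?sqrtr_ge0 // ltW.
  rewrite ltr_pdivrMr //; lra.
have [hw cy _] := h; have cw := radial_cont h.
(* The amplitude that solves b = alpha a^2. *)
pose a := Num.sqrt (b / alpha).
have a0 : 0 < a by rewrite sqrtr_gt0 divr_gt0.
have a2 : a ^+ 2 = b / alpha by rewrite sqr_sqrtr // divr_ge0 ?ltW.
pose u r := a * (r ^+ m * w r).
pose du r := a * (m%:R * r ^+ m.-1 * w r + r ^+ m * y r).
have hu r : is_derive (r : R) 1 u (du r).
  have := derM (der_cst r a) (derM (derX m (der_id r)) (hw r)).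
  by congr is_derive; rewrite /du; ring.
have u'E : derive1 u = du by apply/funext => r; rewrite derive1E; case: (hu r).
have ce t : continuous (fun s : R => s ^+ t) by exact: exprn_continuous.
have cdu : continuous du.
  move=> s; apply: cvgM; first exact: cvg_cst.
  apply: cvgD; apply: cvgM; [|exact: cw|exact: ce|exact: cy].
  by apply: cvgM; [exact: cvg_cst|exact: ce].
have u0 : u 0 = 0 by rewrite /u expr0n gtn_eqF // mul0r mulr0.
have uR : u Rad = 0 by rewrite /u wR !mulr0.
have zE : (fun s => s * derive1 u s) = (fun s => a * (m%:R * s ^+ m * w s + s ^+ m.+1 * y s)).
  apply/funext => s; have sm : s ^+ m = s * s ^+ m.-1 by rewrite -exprS prednK.
  by rewrite u'E /du exprS sm; ring.
exists u; split; [split|split].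
- by move=> r _; case: (hu r).
(* [u] is itself C^1 on the line and vanishes at both ends, so a constant sequence approximates
   it. *)
- exists (fun _ => u); split.
    by move=> k; split=> //; split; [move=> x; case: (hu x)|rewrite u'E].
  have -> : (fun k : nat => Hdist2 Rad u u) = fun=> 0%E.
    apply/funext => _; rewrite /Hdist2 integral0_eq // => r _.
    by rewrite !subrr expr0n /= mulr0 mul0r addr0.
  exact: cvg_cst.
- by move=> r /andP[rp rR]; rewrite /u !mulr_gt0 ?exprn_gt0 // wpos // rR ltW.
- split; first by apply: cont_within => r _; exact: der_cont (hu r).
  do 2 split=> //; move=> r /andP[rp rR].
  have [_ hz] := polar_der h rp.
  have hz' := derM (der_cst r a) hz; rewrite -zE in hz'.
  split; first by case: (hu r).
  have [dz dzE] := hz'; split; first exact: dz.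
  rewrite derive1E dzE nm /reaction /u.
  (* Through alpha a^2 = b the denominators of the vortex equation and of [reaction] coincide. *)
  have d1 : 1 + alpha * (a * (r ^+ m * w r)) ^+ 2 = 1 + b * (r ^+ m) ^+ 2 * w r ^+ 2.
    by rewrite exprMn a2 exprMn; field; rewrite gt_eqF.
  have B0 : 0 <= b * (r ^+ m) ^+ 2 by rewrite mulr_ge0 ?sqr_ge0 // ltW.
  have d0 := sat_den_gt0 (w r) B0.
  have a3 : 2 * r * (a * (r ^+ m * w r)) ^+ 3 = 2 * r * (b / alpha) * a * (r ^+ m * w r) ^+ 3.
    by rewrite exprMn exprS a2; ring.
  rewrite d1 a3 [r ^+ m.+1]exprS; field.
  by rewrite !gt_eqF.
Qed.
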